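(* Let $T>0$, let $p\ge2$ be an integer, $\gamma\in(0,1/p]$ and $V\in\mathcal V^p_\gamma$. Assume there are $K,\kappa>0$ such that $$|b(t,x)|\vee\|\sigma(t,x)\|\le K\left(1+V(x)^{\kappa\gamma}\right),\qquad\forall t\in[0,T],\ x\in\mathbb R^d,$$ and that there are $\nu,q>0$ such that $V(x)\le V(y)\le\nu(1+|y|^q)$ for all $x,y\in\mathbb R^d$ with $|x|\le|y|$. Suppose $\mathbb E V(X_0)<\infty$ and, for some $\rho>0$, $$\mathcal LV(x)\le\rho(1+V(x)),\qquad\forall t\in[0,T],\ x\in\mathbb R^d.$$ Let $\beta_2\le\frac12-\frac1{p\wedge4}$. Then, for $r>0$ with $r\le\dfrac{\beta_2}{(\kappa-1)q\gamma}$, the projected scheme $$\bar X_{k+1}=\Pi\left(\bar X_k+b(t_k,\bar X_k)h+\sigma(t_k,\bar X_k)\Delta W_{k+1}\right)$$ is $V$-integrable, i.e. $$\sup_{h\in(0,1]}\ \max_{0\le k\le\lfloor T/h\rfloor}\mathbb E V(\bar X_k)<\infty.$$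
   Context: $(\Omega,\mathcal F,\mathbb P)$ is a complete probability space with right-continuous filtration $(\mathcal F_t)$; $W$ is an $m$-dimensional $(\mathcal F_t)$-Wiener process; $X_0$ is an $\mathcal F_0$-measurable $\mathbb R^d$-valued random variable. The coefficients $b:[0,T]\times\mathbb R^d\to\mathbb R^d$, $\sigma:[0,T]\times\mathbb R^d\to\mathbb R^{d\times m}$ of the SDE $dX_t=b(t,X_t)dt+\sigma(t,X_t)dW_t$ are locally Lipschitz continuous. The step size is $h\in(0,1]$, $t_k=kh$, $\Delta W_{k+1}=W_{t_{k+1}}-W_{t_k}$; $\|\cdot\|$ is the Hilbert–Schmidt norm; $a\vee b=\max(a,b)$, $a\wedge b=\min(a,b)$. For integers $p\ge2$ and $0<\gamma\le 1/p$, $\mathcal V^p_\gamma$ is the set of $V\in\mathcal C^{p+1}(\mathbb R^d)$ with $V\ge0$, $V(x)=0$ iff $x=0$, and for which there is $c>0$ with $\|V^{(s)}(x)\|_{HS}\le c(1+V(x))^{1-s\gamma}$ for all $x\in\mathbb R^d$ and all $s\le p$, where $V^{(s)}$ is the $s$-th derivative tensor. $\mathcal LV(x)=\langle\nabla V(x),b(t,x)\rangle+\frac12\mathrm{tr}\left[V^{(2)}(x)\sigma(t,x)\sigma(t,x)^\top\right]$, with the dependence on $t$ suppressed in the notation. For a parameter $r>0$ and each $h$, $\Pi=\Pi_{h,r}:\mathbb R^d\to\mathbb R^d$ is a (measurable) map with $|\Pi x|=|x|\wedge h^{-r}$ for all $x$. The scheme is started from $\bar X_0=X_0$ if $|X_0|\le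 h^{-r}$ and from $\bar X_0=\Pi X_0$ otherwise. *)

(* Defs.v *)
From HB Require Import structures.
From mathcomp Require Import all_boot all_order all_algebra.
From mathcomp Require Import all_classical all_reals all_analysis.

Set Implicit Arguments.
Unset Strict Implicit.
Unset Printing Implicit Defensive.

Import Order.TTheory GRing.Theory Num.Theory.
Import numFieldNormedType.Exports.

Local Open Scope classical_set_scope.
Local Open Scope ring_scope.

(* Vectors of R^d are columns 'cV[R]_d.  The library norm `|x| of a matrix is
   the maximum norm; it is used only through the topology and the Lipschitz
   property, which do not depend on the choice of the norm. *)

Section Norms.
Context {R : realType}.

(* Hilbert-Schmidt norm; on columns this is the Euclidean norm. *)
Definition hs_norm {m n : nat} (A : 'M[R]_(m, n)) : R :=
  Num.sqrt (\sum_i \sum_j A i j ^+ 2).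

Definition borel_set {U : topologicalType} : set (set U) := <<s (@open U) >>.

Definition locally_lipschitz_on {U V : normedModType R} (D : set U)
    (f : U -> V) : Prop :=
  forall z, D z -> exists2 A, nbhs z A & [lipschitz f x | x in D `&` A].

End Norms.

Section Derivatives.
Context {R : realType} {d : nat}.
Implicit Types (f V : 'cV[R]_d -> R) (x : 'cV[R]_d).

Definition partial (i : 'I_d) f : 'cV[R]_d -> R :=
  fun x => 'D_(delta_mx i 0) f x.

(* iter_partial [:: i_1; ...; i_s] f = d_{i_1} ... d_{i_s} f *)
Definition iter_partial (s : seq 'I_d) f : 'cV[R]_d -> R := foldr partial f s.

Definition class_C (k : nat) f : Prop :=
  (forall s : seq 'I_d, (size s <= k)%N -> continuous (iter_partial s f)) /\
  (forall (s : seq 'I_d) (i : 'I_d) x, (size s < k)%N ->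
     derivable (iter_partial s f) x (delta_mx i 0)).

(* Hilbert-Schmidt norm of the s-th derivative tensor of f at x. *)
Definition deriv_hs_norm (s : nat) f x : R :=
  Num.sqrt (\sum_(u : s.-tuple 'I_d) iter_partial u f x ^+ 2).

Definition gradient f x : 'cV[R]_d := \col_i partial i f x.

Definition hessian f x : 'M[R]_d :=
  \matrix_(i, j) iter_partial [:: i; j] f x.

Definition lyapunov_class (p : nat) (gamma : R) V : Prop :=
  [/\ class_C p.+1 V,
      forall x, 0 <= V x,
      forall x, V x = 0 <-> x = 0 &
      exists2 c : R, 0 < c &
        forall x (s : nat), (s <= p)%N ->
          deriv_hs_norm s V x <= c * (1 + V x) `^ (1 - s%:R * gamma)].

Definition generator {m : nat} (b : R -> 'cV[R]_d -> 'cV[R]_d)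
    (sigma : R -> 'cV[R]_d -> 'M[R]_(d, m)) V (t : R) x : R :=
  ((gradient V x)^T *m b t x) 0 0
  + 2^-1 * \tr (hessian V x *m sigma t x *m (sigma t x)^T).

End Derivatives.

Definition increment {R : realType} {Omega : Type} {m : nat}
    (W : R -> Omega -> 'cV[R]_m) (s t : R) (w : Omega) : 'cV[R]_m :=
  W t w - W s w.

Section Probability.
Context {R : realType} {disp : measure_display} {Omega : measurableType disp}.
Variable P : probability Omega R.
Implicit Types F : R -> set (set Omega).

(* Families indexed by time are functions on R of which only the values at
   nonnegative times matter. *)

Definition filtration F : Prop :=
  [/\ forall t : R, 0 <= t -> sigma_algebra [set: Omega] (F t),
      forall t : R, 0 <= t -> F t `<=` measurable &
      forall s t : R, 0 <= s -> s <= t -> F s `<=` F t].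

Definition right_continuous_filtration F : Prop :=
  forall t : R, 0 <= t -> F t = \bigcap_(s in [set s : R | t < s]) F s.

Definition measurable_wrt (G : set (set Omega)) {U : topologicalType}
    (X : Omega -> U) : Prop :=
  forall B, borel_set B -> G (X @^-1` B).

Definition wiener_process F {m : nat} (W : R -> Omega -> 'cV[R]_m) : Prop :=
  [/\ forall t : R, 0 <= t -> measurable_wrt (F t) (W t),
      {ae P, forall w, W 0 w = 0},
      {ae P, forall w, {within [set t : R | 0 <= t], continuous (W ^~ w)}},
      (* increments are independent of the past *)
      forall (s t : R) (A : set Omega) (B : set 'cV[R]_m),
        0 <= s -> s < t -> F s A -> borel_set B ->
        P (A `&` increment W s t @^-1` B)
        = (P A * P (increment W s t @^-1` B))%E &
      (* W t - W s has law N(0, (t - s) I_m), given by its values on boxes;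
         the second parameter of normal_prob is the standard deviation *)
      forall (s t : R) (B : 'I_m -> set R),
        0 <= s -> s < t -> (forall i, measurable (B i)) ->
        P [set w | forall i, B i (increment W s t w i 0)]
        = (\prod_(i < m) normal_prob 0 (Num.sqrt (t - s)) (B i))%E].

End Probability.

Section Scheme.
Context {R : realType} {Omega : Type} {d m : nat}.

(* Pi is the projection for the given step h; the time t_k is k * h. *)
Fixpoint projected_scheme (b : R -> 'cV[R]_d -> 'cV[R]_d)
    (sigma : R -> 'cV[R]_d -> 'M[R]_(d, m)) (W : R -> Omega -> 'cV[R]_m)
    (X0 : Omega -> 'cV[R]_d) (r h : R) (Pi : 'cV[R]_d -> 'cV[R]_d)
    (k : nat) (w : Omega) : 'cV[R]_d :=
  if k is k'.+1 then
    let X := projected_scheme b sigma W X0 r h Pi k' w in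
    Pi (X + h *: b (k'%:R * h) X
          + sigma (k'%:R * h) X *m increment W (k'%:R * h) (k'.+1%:R * h) w)
  else if hs_norm (X0 w) <= h `^ (- r) then X0 w else Pi (X0 w).

Definition projection_map (r h : R) (Pi : 'cV[R]_d -> 'cV[R]_d) : Prop :=
  (forall B, borel_set B -> borel_set (Pi @^-1` B)) /\
  (forall x, hs_norm (Pi x) = Num.min (hs_norm x) (h `^ (- r))).

End Scheme.

(* X h k is the k-th iterate of the scheme with step h. *)
Definition V_integrable {R : realType} {disp : measure_display}
    {Omega : measurableType disp} (P : probability Omega R) {d : nat}
    (T : R) (V : 'cV[R]_d -> R) (X : R -> nat -> Omega -> 'cV[R]_d) : Prop :=
  (ereal_sup
    [set \big[maxe/-oo]_(k < (Num.truncn (T / h)).+1) 'E_P[V \o X h k]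
       | h in [set h : R | (0 < h <= 1)%R]] < +oo)%E.

(* Main.v *)
(** One step of the scheme satisfies
    [E (1 + V X_{k+1}) <= (1 + C h) E (1 + V X_k)] with [C] independent of [h],
    and the discrete Gronwall inequality concludes.  The projection only
    decreases [V], so it suffices to bound [E V(x + h b + sigma e)] for a fixed
    [x] with [|x| <= h^-r] and a centred Gaussian [e] of variance [h].  On that
    ball the coefficients are at most [K' (1 + V x)^gamma h^-beta] with
    [beta <= 1/2 - 1/n], [n = min(p, 4)] (for [kappa <= 1] one takes [beta = 0],
    [n = 2]).  Since [e] is symmetric, [V(y + sigma e)] may be replaced by the
    even average of [V(y + sigma e)] and [V(y - sigma e)], [y = x + h b], whose
    Taylor expansion of order [n] has no odd terms; its second order term and
    the drift produce [h * L V (x)] up to [O(h (1 + V x))].  The remainders are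
    controlled because [(1 + V)^gamma] is Lipschitz, so that [1 + V] at the
    intermediate points is at most [C (1 + V x) exp(|e| / (gamma sqrt h))],
    and [e] has exponential moments. *)
Require Import Defs.
From HB Require Import structures.
From mathcomp Require Import all_boot all_order all_algebra.
From mathcomp Require Import all_classical all_reals all_analysis.
From mathcomp Require Import measurable_realfun ring lra.

Set Implicit Arguments.
Unset Strict Implicit.
Unset Printing Implicit Defensive.

Import Order.TTheory GRing.Theory Num.Theory.
Import numFieldNormedType.Exports.

Local Open Scope classical_set_scope.
Local Open Scope ring_scope.

(** * Taylor expansion along lines *)

(** Everything reduces to counting powers. A derivative of order s is O((1 + V)^(1 - s gamma)) and
    each direction, drift or noise, is O((1 + V)^gamma), so every Taylor term is O(1 + V) and only
    powers of the step remain to be compared. If the coefficients grow like eta = h^-beta, the scale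
    is delta = sqrt h * eta: a noise direction counts delta, a drift direction sqrt h * delta, and
    beta <= 1/2 - 1/n says exactly that delta^n <= h. Order n is thus one at which the remainder is
    admissible. The obstacle is the second order noise term, of size delta^2, which may be much
    larger than h: it cannot be estimated and has to be averaged exactly and matched with L V. Hence
    the second moments of the Gaussian are computed exactly, while an exponential moment is enough
    for all the rest. Symmetrising the integrand removes the odd orders before integration, so that
    no third moment occurs and n = 3 and n = 4 are treated together. *)

Lemma derivable1_bound {R : realType} (f f' : R -> R) (M t : R) :
  (forall s : R, is_derive s 1 f (f' s)) -> 0 <= M ->
  (forall s : R, 0 <= s <= 1 -> f' s <= M) -> 0 <= t <= 1 -> f t <= f 0 + M.
Proof.
move=> df M0 bf /andP[t0 t1].
have cf : {within `[0, t], continuous f}.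
  apply: continuous_subspaceT => x.
  by apply: differentiable_continuous; apply/derivable1_diffP; apply: ex_derive.
have [c] := MVT_segment t0 (fun x _ => df x) cf.
rewrite in_itv/= subr0 => /andP[c0 ct] fE.
rewrite -lerBlDl fE; have f'c := bf c; rewrite c0 (le_trans ct t1) in f'c.
nra.
Qed.

(** Subtracting the top Taylor term reduces to the previous order, and the first order bound
    controls the derivative that is left. The remainder keeps neither its power of [t] nor its
    factorial, since constants are absorbed later. *)
Lemma taylor2_bound {R : realType} (f f1 f2 : R -> R) (M t : R) :
  (forall s : R, is_derive s 1 f (f1 s)) -> (forall s : R, is_derive s 1 f1 (f2 s)) ->
  0 <= M -> (forall s : R, 0 <= s <= 1 -> f2 s <= M) -> 0 <= t <= 1 ->
  f t <= f 0 + t * f1 0 + M.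
Proof.
move=> df df1 M0 bf2 t01.
pose g s := f s - s * f1 0.
have dg (s : R) : is_derive s 1 g (f1 s - f1 0).
  by apply: is_derive_eq; rewrite scaler0 add0r scaler1.
have := derivable1_bound dg M0 _ t01; rewrite /g mul0r subr0.
rewrite lerBlDr addrAC; apply=> s s01; rewrite lerBlDl.
exact: derivable1_bound df1 M0 bf2 s01.
Qed.

Lemma taylor3_bound {R : realType} (f f1 f2 f3 : R -> R) (M t : R) :
  (forall s : R, is_derive s 1 f (f1 s)) -> (forall s : R, is_derive s 1 f1 (f2 s)) ->
  (forall s : R, is_derive s 1 f2 (f3 s)) ->
  0 <= M -> (forall s : R, 0 <= s <= 1 -> f3 s <= M) -> 0 <= t <= 1 ->
  f t <= f 0 + t * f1 0 + t ^+ 2 / 2 * f2 0 + M.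
Proof.
move=> df df1 df2 M0 bf3 t01.
pose g s := f s - s ^+ 2 / 2 * f2 0.
have dg (s : R) : is_derive s 1 g (f1 s - s * f2 0).
  rewrite /g; apply: is_derive_eq.
  by rewrite /GRing.scale/=; field.
pose g1 s := f1 s - s * f2 0.
have dg1 (s : R) : is_derive s 1 g1 (f2 s - f2 0).
  by rewrite /g1; apply: is_derive_eq; rewrite scaler0 add0r scaler1.
have := taylor2_bound dg dg1 M0 _ t01.
rewrite /g /g1 expr0n/= !mul0r !subr0 => H.
have : f t - t ^+ 2 / 2 * f2 0 <= f 0 + t * f1 0 + M; last by lra.
apply: H => s s01; rewrite lerBlDl.
exact: derivable1_bound df2 M0 bf3 s01.
Qed.

Section line.
Context {R : realType} {d : nat}.
Variable f : 'cV[R]_d -> R.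
Hypothesis df : forall i x, derivable f x (delta_mx i 0).
Hypothesis cf : forall i, continuous (partial i f).

Lemma is_derive_line (x w : 'cV[R]_d) (t l : R) :
  is_derive (x + t *: w) w f l -> is_derive t 1 (fun s => f (x + s *: w)) l.
Proof.
have E : (fun h => h^-1 *: (f (h *: w + (x + t *: w)) - f (x + t *: w)))
    = (fun h => h^-1 *: (f (x + (h *: 1 + t) *: w) - f (x + t *: w))).
  by apply/funext => h; rewrite scaler1 scalerDl addrCA.
case=> dfx <-; split; rewrite /derivable /derive.
  by move: dfx; rewrite /derivable; rewrite /= E.
by rewrite /= E.
Qed.

(** Coordinates are changed one at a time: the increment in one coordinate is a mean value of a
    partial derivative, which converges by continuity. The induction runs over a list of
    coordinates, [v] being the displacement along the remaining ones. *)
Lemma is_derive_direction (x w : 'cV[R]_d) :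
  is_derive x w f (\sum_i w i 0 * partial i f x).
Proof.
suff H (r : seq 'I_d) (u : 'I_d -> R) (y : 'cV[R]_d) :
    is_derive y (\sum_(i <- r) u i *: delta_mx i 0) f
      (\sum_(i <- r) u i * partial i f y).
  have := H (index_enum 'I_d) (fun i => w i 0) x.
  congr is_derive; rewrite [RHS]matrix_sum_delta.
  by apply: eq_bigr => i _; rewrite big_ord1.
elim: r y => [|i r IH] y.
  rewrite !big_nil; split; first exact: derivable0.
  exact: derive0.
rewrite !big_cons; set v := \sum_(j <- r) _; set l := \sum_(j <- r) _ in IH *.
set a := u i; set e := delta_mx i 0.
suff cv : (fun h => h^-1 *: (f (h *: (a *: e + v) + y) - f y)) @ 0^' -->
     a * partial i f y + \sum_(j <- r) u j * partial j f y.
  split; first by apply: cvgP cv.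
  exact: cvg_lim cv.
have [dv dvE] := IH y.
have cv2 : (fun h => h^-1 *: (f (h *: v + y) - f y)) @ 0^' -->
     \sum_(j <- r) u j * partial j f y by rewrite -dvE.
have -> : (fun h => h^-1 *: (f (h *: (a *: e + v) + y) - f y)) =
   (fun h => h^-1 *: (f (h *: (a *: e + v) + y) - f (h *: v + y))) \+
   (fun h => h^-1 *: (f (h *: v + y) - f y)).
  by apply/funext => h /=; rewrite -scalerDr addrA subrK.
apply: cvgD cv2.
have mvt h : exists2 c, 0 <= c <= 1 &
    f (h *: (a *: e + v) + y) - f (h *: v + y)
    = h * a * partial i f (y + h *: (v + (c * a) *: e)).
  pose g s := f ((y + h *: v) + s *: e).
  (* Running through the segment with [s] in [0, 1] avoids a case distinction on the sign of
     [h * a]. *)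
  pose k s : R := s * (h * a).
  have dg (s : R) : is_derive s 1 g (partial i f ((y + h *: v) + s *: e)).
    apply: is_derive_line; split => //; exact: df.
  have dk (s : R) : is_derive s 1 k (h * a).
    by apply: is_derive_eq; rewrite scaler0 add0r scaler1.
  have dgk (s : R) : is_derive s 1 (g \o k)
      (partial i f ((y + h *: v) + k s *: e) * (h * a)).
    exact: is_derive1_comp.
  have cgk : {within `[0, 1], continuous (g \o k)}.
    apply: continuous_subspaceT => s.
    by apply: differentiable_continuous; apply/derivable1_diffP; apply: ex_derive.
  have [c] := MVT_segment ler01 (fun x _ => dgk x) cgk.
  rewrite in_itv/= => c01; rewrite subr0 mulr1 /g /k /= mul0r mul1r scale0r addr0.
  move=> E; exists c => //.
  have -> : h *: (a *: e + v) + y = y + h *: v + (h * a) *: e.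
    by rewrite scalerDr scalerA [RHS]addrC (addrC y) addrA.
  have -> : y + h *: (v + (c * a) *: e) = y + h *: v + (c * (h * a)) *: e.
    by rewrite scalerDr scalerA addrA mulrCA.
  by rewrite (addrC (h *: v) y) E mulrC.
have cn : partial i f z @[z --> y] --> partial i f y by exact: cf.
apply/cvgrPdist_le => eps eps0 /=.
have a1 : 0 < `|a| + 1 by rewrite ltr_wpDl.
have /cvgrPdist_le/(_ (eps / (`|a| + 1))) := cn; rewrite divr_gt0// => /(_ isT).
move=> /nbhs_normP[del /= del0 Hdel].
pose M := `|v| + `|a| * `|e| + 1.
have M0 : 0 < M by rewrite ltr_wpDl// addr_ge0// mulr_ge0.
near=> h.
have h0 : h != 0 by near: h; exact: nbhs_dnbhs_neq.
have hM : `|h| < del / M.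
  near: h; apply: dnbhs0_lt; exact: divr_gt0.
have [c /andP[c0 c1] ->] := mvt h.
rewrite /GRing.scale/= -mulrA (mulrA h^-1) mulVf// mul1r -mulrBr normrM.
have H : `|partial i f y - partial i f (y + h *: (v + (c * a) *: e))|
      <= eps / (`|a| + 1).
  apply: Hdel => /=; rewrite opprD addrA subrr add0r normrN normrZ.
  rewrite ltr_pdivlMr// in hM; apply: le_lt_trans hM.
  rewrite ler_wpM2l// /M (le_trans (ler_normD _ _))// -addrA lerD2l.
  rewrite normrZ normrM (ger0_norm c0).
  rewrite (@le_trans _ _ (`|a| * `|e|)) ?lerDl//.
  by rewrite ler_wpM2r// ler_piMl.
rewrite (@le_trans _ _ ((`|a| + 1) * (eps / (`|a| + 1))))//.
  by apply: ler_pM => //; rewrite lerDl.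
by rewrite mulrC divfK// gt_eqF.
Unshelve. all: by end_near.
Qed.

End line.

(** * Iterated directional derivatives *)

Section dirD.
Context {R : realType} {d : nat}.
Implicit Types (x u w : 'cV[R]_d) (s : seq 'I_d).

(** With the l1 norm, expanding a directional derivative in coordinates costs no constant: a bound
    on all partial derivatives is just multiplied by the norms of the directions. *)
Definition norm1 u : R := \sum_i `|u i 0|.

Lemma norm1_ge0 u : 0 <= norm1 u.
Proof. exact: sumr_ge0. Qed.

Lemma norm1D u w : norm1 (u + w) <= norm1 u + norm1 w.
Proof.
by rewrite /norm1 -big_split; apply: ler_sum => i _; rewrite mxE ler_normD.
Qed.

Lemma norm1Z a u : norm1 (a *: u) = `|a| * norm1 u.
Proof. by rewrite /norm1 mulr_sumr; apply: eq_bigr => i _; rewrite mxE normrM. Qed.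

Variable V : 'cV[R]_d -> R.

(* dirD [:: u_1; ...; u_k] s = D_{u_k} ... D_{u_1} (iter_partial s V) *)
Fixpoint dirD (us : seq 'cV[R]_d) s x : R :=
  if us is u :: us' then \sum_i u i 0 * dirD us' (i :: s) x
  else iter_partial s V x.

(** The head direction pushes its index first, so the last direction carries the outermost partial
    derivative, and a further derivation is appended by [rcons]. Mixed partial derivatives are never
    exchanged. *)
Lemma is_derive_dirD k us s x w (t : R) :
  class_C k V -> (size us + size s < k)%N ->
  is_derive t 1 (fun r => dirD us s (x + r *: w))
    (dirD (rcons us w) s (x + t *: w)).
Proof.
move=> [cV dV]; elim: us s => [|u us IH] s /= sk.
  apply: is_derive_line; apply: is_derive_direction => [i y|i].
    exact: dV.
  exact: (cV (i :: s)).
have -> : (fun r => \sum_i u i 0 * dirD us (i :: s) (x + r *: w)) =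
  \sum_i (fun r => u i 0 * dirD us (i :: s) (x + r *: w)).
  by apply/funext => r; rewrite fct_sumE.
apply: is_derive_sum => i.
have -> : (fun r => u i 0 * dirD us (i :: s) (x + r *: w)) =
  u i 0 \*: (fun r => dirD us (i :: s) (x + r *: w)) by [].
by apply: is_deriveZ; apply: IH; rewrite /= addnS -addSn.
Qed.

Lemma dirD_norm_le us s x M :
  (forall s', size s' = (size us + size s)%N -> `|iter_partial s' V x| <= M) ->
  `|dirD us s x| <= (\prod_(u <- us) norm1 u) * M.
Proof.
elim: us s => [|u us IH] s H /=; first by rewrite big_nil mul1r; exact: H.
rewrite big_cons /norm1 mulr_suml mulr_suml.
apply: le_trans (ler_norm_sum _ _ _) _; apply: ler_sum => i _.
rewrite normrM -mulrA ler_wpM2l//; apply: IH => s' ss; apply: H.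
by rewrite ss /= addnS.
Qed.

Lemma iter_partial_le s x : `|iter_partial s V x| <= deriv_hs_norm (size s) V x.
Proof.
rewrite -sqrtr_sqr /deriv_hs_norm ler_wsqrtr//.
rewrite (bigD1 (in_tuple s))//= lerDl.
by apply: sumr_ge0 => u _; exact: sqr_ge0.
Qed.

End dirD.

(** * Growth of V and of its derivatives under displacements *)

Section lyapunov_growth.
Context {R : realType} {d : nat}.
Variables (p : nat) (gamma c : R) (V : 'cV[R]_d -> R).
Hypotheses (p_gt0 : (0 < p)%N) (gamma_gt0 : 0 < gamma)
  (gammap : gamma <= p%:R^-1).
Hypotheses (VC : class_C p.+1 V) (V_ge0 : forall x, 0 <= V x) (c_gt0 : 0 < c).
Hypothesis DV : forall x (s : nat), (s <= p)%N ->
  deriv_hs_norm s V x <= c * (1 + V x) `^ (1 - s%:R * gamma).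

Let U_ge1 x : 1 <= 1 + V x. Proof. by rewrite lerDl. Qed.
Let U_gt0 x : 0 < 1 + V x. Proof. exact: lt_le_trans ltr01 _. Qed.
Let U_ge0 x : 0 <= 1 + V x. Proof. exact: ltW. Qed.

Lemma dirD_growth us x : (size us <= p)%N ->
  `|dirD V us [::] x| <= (\prod_(u <- us) norm1 u) *
    (c * (1 + V x) `^ (1 - (size us)%:R * gamma)).
Proof.
move=> sp; apply: dirD_norm_le => s1; rewrite addn0 => ss; rewrite -ss in sp *.
by apply: le_trans (iter_partial_le _ _ _) _; exact: DV.
Qed.

(** The derivative of (1 + V)^gamma along [w] is gamma (1 + V)^(gamma - 1) times that of V, which is
    at most c (1 + V)^(1 - gamma) |w| by the growth condition for s = 1: the powers cancel. *)
Lemma lyapunov_powR_lipschitz x w :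
  (1 + V (x + w)) `^ gamma <= (1 + V x) `^ gamma + gamma * c * norm1 w.
Proof.
pose f r := (1 + V (x + r *: w)).
have df (r : R) : is_derive r 1 f (dirD V [:: w] [::] (x + r *: w)).
  have -> : f = cst 1 + (fun r => dirD V [::] [::] (x + r *: w)) by [].
  rewrite -[X in is_derive _ _ _ X]add0r; apply: is_deriveD.
  by apply: (@is_derive_dirD _ _ _ p.+1).
have dg (r : R) : is_derive r 1 (@powR R ^~ gamma \o f)
    (gamma * f r `^ (gamma - 1) * dirD V [:: w] [::] (x + r *: w)).
  by apply: is_derive1_comp; apply: is_derive1_powR; exact: U_gt0.
have := @derivable1_bound _ _ _ (gamma * c * norm1 w) 1 dg.
rewrite /f /= scale1r scale0r addr0; apply; rewrite ?ler01 ?lexx//.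
  by rewrite !mulr_ge0 ?norm1_ge0// ltW.
move=> r _; have := @dirD_growth [:: w] (x + r *: w) p_gt0.
rewrite big_cons big_nil mulr1 mul1r => /ler_normlW H.
rewrite -!mulrA ler_wpM2l ?(ltW gamma_gt0)//.
apply: le_trans (ler_wpM2l (powR_ge0 _ _) H) _.
rewrite (mulrCA _ (norm1 w)) (mulrCA _ c) -powRD; last first.
  by apply/implyP => _; rewrite gt_eqF//; exact: U_gt0.
by rewrite addrC subrKA subrr powRr0 mulr1 mulrC.
Qed.

(** With U = 1 + V x and k directions, the directions supply U^(k gamma) and the derivative of order
    k supplies U^(1 - k gamma), whence the factor 1 + V x. Of the exponent, 4 z comes from the
    directions and z / gamma from moving the derivative back from x + w to x. *)
Lemma dirD_remainder (A z h : R) us x w :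
  0 <= A -> 0 <= z -> 0 <= h -> (size us <= p)%N ->
  norm1 w <= A * (1 + z) * (1 + V x) `^ gamma ->
  \prod_(u <- us) norm1 u <= (1 + A) ^+ 4 * h * expR (4 * z)
     * ((1 + V x) `^ gamma) ^+ (size us) ->
  `|dirD V us [::] (x + w)| <=
    c * (1 + A) ^+ 4 * (1 + gamma * c * A) `^ gamma^-1 *
      (h * (1 + V x) * expR ((4 + gamma^-1) * z)).
Proof.
move=> A0 z0 h0 sp nw nus.
apply: le_trans (dirD_growth _ sp) _.
set U := 1 + V x; set k := size us in nus sp *; set P := \prod_(u <- us) _.
have g0 : gamma != 0 by rewrite gt_eqF.
have kg : k%:R * gamma <= 1.
  rewrite (@le_trans _ _ (p%:R * gamma))//.
    by rewrite ler_wpM2r ?(ltW gamma_gt0)// ler_nat.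
  by rewrite -ler_pdivlMl ?ltr0n// mulr1.
set B := (1 + gamma * c * A).
have B1 : 1 <= B by rewrite lerDl !mulr_ge0// ltW.
have gK t (a : R) : 0 <= t -> t `^ a = (t `^ gamma) `^ (a / gamma).
  by move=> t0; rewrite -powRrM mulrC divfK.
have B0 : 0 <= B by exact: le_trans ler01 _.
have ez : 1 + z <= expR z by exact: expR_ge1Dx.
have Ug : 1 <= U `^ gamma.
  by rewrite -(powRr0 U) ler_powR ?(ltW gamma_gt0)//; exact: U_ge1.
have H1 : (1 + V (x + w)) `^ gamma <= B * expR z * U `^ gamma.
  apply: le_trans (lyapunov_powR_lipschitz _ _) _.
  rewrite -/U; apply: (@le_trans _ _ (B * (1 + z) * U `^ gamma)); last first.
    by rewrite ler_wpM2r ?powR_ge0// ler_wpM2l.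
  rewrite /B; have : gamma * c * norm1 w <= gamma * c * (A * (1 + z) * U `^ gamma).
    by rewrite ler_wpM2l// mulr_ge0// ltW.
  have : 0 <= z * U `^ gamma by rewrite mulr_ge0// powR_ge0.
  lra.
(* The exponent (1 - k gamma) / gamma lies between 0, because gamma <= 1/p, and 1 / gamma, so
   raising [H1] to it costs at most B^(1/gamma) exp(z / gamma). *)
have H2 : (1 + V (x + w)) `^ (1 - k%:R * gamma)
    <= B `^ gamma^-1 * expR (gamma^-1 * z) * U `^ (1 - k%:R * gamma).
  have e0 : 0 <= (1 - k%:R * gamma) / gamma.
    by rewrite divr_ge0 ?subr_ge0// ltW.
  have e1 : (1 - k%:R * gamma) / gamma <= gamma^-1.
    rewrite ler_pdivrMr// mulVf// gerBl mulr_ge0//; exact: ltW.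
  rewrite gK// [U `^ _]gK; last exact: U_ge0.
  apply: le_trans (ge0_ler_powR e0 _ _ H1) _.
  - by rewrite nnegrE powR_ge0.
  - by rewrite nnegrE !mulr_ge0 ?expR_ge0 ?powR_ge0.
  rewrite !powRM ?mulr_ge0 ?expR_ge0 ?powR_ge0//.
  rewrite ler_wpM2r ?powR_ge0// ler_pM ?powR_ge0//.
    exact: ler_powR.
  rewrite -expRM ler_expR mulrC ler_wpM2r//.
have P0 : 0 <= P by apply: prodr_ge0 => u _; exact: norm1_ge0.
apply: (@le_trans _ _ (P * (c * (B `^ gamma^-1 * expR (gamma^-1 * z) * U `^ (1 - k%:R * gamma))))).
  by rewrite ler_wpM2l// ler_wpM2l// ltW.
apply: le_trans (ler_wpM2r _ nus) _.
  by rewrite !mulr_ge0 ?powR_ge0 ?expR_ge0// ltW.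
rewrite -/B -/U (mulrDl 4) expRD.
have : (U `^ gamma) ^+ k * U `^ (1 - k%:R * gamma) = U.
  rewrite -powR_mulrn ?powR_ge0// -powRrM (mulrC gamma) -powRD; last first.
    by apply/implyP => _; rewrite gt_eqF//; exact: U_gt0.
  by rewrite addrC subrK powRr1//; exact: U_ge0.
move: (U `^ (1 - k%:R * gamma)) (U `^ gamma) => u2 u1 uE; rewrite -uE.
by rewrite le_eqVlt; apply/orP; left; apply/eqP; ring.
Qed.

End lyapunov_growth.

Lemma dirD_opp {R : realType} {d : nat} (V : 'cV[R]_d -> R) us s x :
  dirD V (map -%R us) s x = (-1) ^+ size us * dirD V us s x.
Proof.
elim: us s => [|u us IH] s /=; first by rewrite mul1r.
rewrite mulr_sumr; apply: eq_bigr => i _; rewrite IH mxE exprS; ring.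
Qed.

(** * One step for a fixed value of the noise *)

Section one_step_pointwise.
Context {R : realType} {d : nat}.
Variables (p : nat) (gamma c : R) (V : 'cV[R]_d -> R).
Hypotheses (gamma_gt0 : 0 < gamma) (gammap : gamma <= p%:R^-1).
Hypotheses (VC : class_C p.+1 V) (V_ge0 : forall x, 0 <= V x) (c_gt0 : 0 < c).
Hypothesis DV : forall x (s : nat), (s <= p)%N ->
  deriv_hs_norm s V x <= c * (1 + V x) `^ (1 - s%:R * gamma).
Variables (n : nat) (x w u : 'cV[R]_d) (A k delta z : R).
Hypotheses (n2 : (2 <= n)%N) (n4 : (n <= 4)%N) (np : (n <= p)%N).
Hypotheses (A0 : 0 <= A) (k0 : 0 < k) (k1 : k <= 1) (z0 : 0 <= z).
Hypotheses (delta0 : 0 <= delta) (deltan : delta ^+ n <= k ^+ 2).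
Hypothesis nw : norm1 w <= A * (1 + V x) `^ gamma * (k * delta).
Hypothesis nu : norm1 u <= A * (1 + V x) `^ gamma * (delta * z).

Let G := (1 + V x) `^ gamma.
(** A common bound for all Taylor remainders below. In the application [k] is the standard deviation
    sqrt h, [delta] is [k * eta], and [z] is the norm of the noise divided by [k]. *)
Let M := c * (1 + A) ^+ 4 * (1 + gamma * c * A) `^ gamma^-1 *
   (k ^+ 2 * (1 + V x) * expR ((4 + gamma^-1) * z)).

Let p0 : (0 < p)%N. Proof. exact: leq_trans (ltnW n2) np. Qed.
Let G0 : 0 <= G. Proof. exact: powR_ge0. Qed.
Let M0 : 0 <= M.
Proof. by rewrite !mulr_ge0 ?expR_ge0 ?powR_ge0 ?exprn_ge0 ?addr_ge0 ?(ltW k0) ?(ltW c_gt0). Qed.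

Let delta1 : delta <= 1.
Proof.
rewrite -(@expr_le1 _ n)//; last exact: leq_trans n2.
by apply: le_trans deltan _; rewrite expr_le1// ltW.
Qed.

Let zexp j : (j <= 4)%N -> z ^+ j <= expR (4 * z).
Proof.
move=> j4; apply: (@le_trans _ _ (expR z ^+ j)).
  by rewrite lerXn2r ?nnegrE ?expR_ge0// (le_trans _ (expR_ge1Dx z)) ?lerDr.
by rewrite -expRM_natl ler_expR ler_wpM2r// ler_nat.
Qed.

(** Puts the product of the norms of the directions in the form required by [dirD_remainder]: at
    most four factors [A] and [z] are absorbed in (1 + A)^4 and exp(4 z), and the powers of the
    small parameters are collected in [kap], which only has to be at most [k ^+ 2]. *)
Let size_bound (y : R) i j l kap : (i <= 4)%N -> (j <= 4)%N -> 0 <= kap ->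
  kap <= k ^+ 2 -> y <= A ^+ i * kap * z ^+ j * G ^+ l ->
  y <= (1 + A) ^+ 4 * k ^+ 2 * expR (4 * z) * G ^+ l.
Proof.
move=> i4 j4 kap0 kapk yle; apply: le_trans yle _.
rewrite ler_wpM2r ?exprn_ge0// ler_pM ?mulr_ge0 ?exprn_ge0//; last exact: zexp.
rewrite ler_pM ?exprn_ge0//.
apply: (@le_trans _ _ ((1 + A) ^+ i)).
  by rewrite lerXn2r ?nnegrE ?lerDr ?addr_ge0.
by rewrite ler_weXn2l// lerDl.
Qed.

(** Every intermediate point has the form x + t w + t' u; as [k] and [delta] are at most 1, its
    distance to x is at most A (1 + z) (1 + V x)^gamma. Negative [t'] serve the reflected noise. *)
Let remainder us (t t' : R) : 0 <= t <= 1 -> `|t'| <= 1 -> (size us <= p)%N ->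
  \prod_(v <- us) norm1 v <= (1 + A) ^+ 4 * k ^+ 2 * expR (4 * z)
     * G ^+ (size us) ->
  dirD V us [::] (x + (t *: w + t' *: u)) <= M.
Proof.
move=> /andP[t0 t1] t'1 us_p H; apply: ler_normlW; rewrite /M.
apply: (dirD_remainder p0 gamma_gt0 gammap VC V_ge0 c_gt0 DV A0 z0 _ us_p _ H).
  by rewrite exprn_ge0// ltW.
apply: le_trans (norm1D _ _) _; rewrite !norm1Z (ger0_norm t0).
apply: (@le_trans _ _ (norm1 w + norm1 u)).
  by rewrite lerD// ler_piMl// norm1_ge0.
have : k * delta <= 1 by rewrite mulr_ile1// ltW.
have : delta * z <= z by rewrite ler_piMl.
move=> H1 H2.
apply: le_trans (lerD nw nu) _; rewrite -/G.
rewrite -mulrDr mulrAC ler_wpM2r// ler_wpM2l//.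
exact: lerD.
Qed.

Let normN v : norm1 (- v : 'cV[R]_d) = norm1 v.
Proof. by rewrite -scaleN1r norm1Z normrN1 mul1r. Qed.

Let y := x + w.
(** [g 0] is the even average of V along the noise, and [g j] is its derivative of order j: the
    signs of the reflected half are carried by the directions - u. *)
Let g j t := 2^-1 * (dirD V (nseq j u) [::] (y + t *: u)
                   + dirD V (nseq j (- u)) [::] (y + t *: (- u))).

Let dg j (t : R) : (j < n)%N -> is_derive t 1 (g j) (g j.+1 t).
Proof.
move=> jn.
have D v : is_derive t 1 (fun r => dirD V (nseq j v) [::] (y + r *: v))
    (dirD V (nseq j.+1 v) [::] (y + t *: v)).
  have -> : nseq j.+1 v = rcons (nseq j v) v.
    by elim: (j) => //= i ->.
  apply: is_derive_dirD VC _; rewrite size_nseq addn0 ltnS.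
  exact: leq_trans (ltnW jn) np.
have -> : g j = 2^-1 \*: ((fun r => dirD V (nseq j u) [::] (y + r *: u)) +
   (fun r => dirD V (nseq j (- u)) [::] (y + r *: (- u)))) by [].
by apply: is_deriveZ; apply: is_deriveD.
Qed.

Let g_odd j : odd j -> g j 0 = 0.
Proof.
move=> oj; rewrite /g !scale0r addr0.
have -> : nseq j (- u) = map -%R (nseq j u) by rewrite map_nseq.
by rewrite dirD_opp size_nseq -signr_odd oj mulN1r subrr mulr0.
Qed.

Let g_even j : ~~ odd j -> g j 0 = dirD V (nseq j u) [::] y.
Proof.
move=> oj; rewrite /g !scale0r addr0.
have -> : nseq j (- u) = map -%R (nseq j u) by rewrite map_nseq.
rewrite dirD_opp size_nseq -signr_odd (negbTE oj) mul1r; lra.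
Qed.

Let prod_nseq (v : 'cV[R]_d) j : \prod_(v' <- nseq j v) norm1 v' = norm1 v ^+ j.
Proof. by elim: j => [|j IH] /=; rewrite ?big_nil ?big_cons ?IH ?exprS. Qed.

(** The order n is calibrated here: n noise directions contribute delta^n, which is at most k^2. *)
Let g_n t : 0 <= t <= 1 -> g n t <= M.
Proof.
move=> /andP[t0 t1].
have H v (t' : R) : `|t'| <= 1 -> norm1 v = norm1 u ->
    dirD V (nseq n v) [::] (x + (1 *: w + t' *: u)) <= M.
  move=> t'1 nvu; apply: remainder => //; rewrite ?ler01 ?lexx ?size_nseq//.
  rewrite prod_nseq nvu; apply: (@size_bound _ n n n (delta ^+ n)) => //.
    exact: exprn_ge0.
  apply: le_trans (lerXn2r _ _ _ nu) _; rewrite ?nnegrE ?norm1_ge0//.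
    by rewrite !mulr_ge0.
  by rewrite !exprMn -/G le_eqVlt; apply/orP; left; apply/eqP; ring.
have := H u t; have := H (- u) (- t).
rewrite normrN (ger0_norm t0) normN scale1r => /(_ t1 erefl) H1 /(_ t1 erefl) H2.
rewrite /g scalerN -scaleNr /y -!addrA; lra.
Qed.

Let gE : g 0 1 = 2^-1 * (V (x + w + u) + V (x + w - u)).
Proof. by rewrite /g /= !scale1r. Qed.

(** For n = 2 the hypothesis on [delta] gives delta <= k, so the second order noise term and the
    first order drift term are both of the admissible size k^2, and each costs one [M]. *)
Lemma one_step_pointwise2 : n = 2 ->
  2^-1 * (V (x + w + u) + V (x + w - u)) <= V x + 2 * M.
Proof.
move=> n_2.
have := @taylor2_bound _ (g 0) (g 1) (g 2) M 1.
rewrite gE (@g_odd 1 isT) mulr0 addr0 (@g_even 0 isT) /= => H.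
have {}H : 2^-1 * (V (x + w + u) + V (x + w - u)) <= V y + M.
  apply: H.
  - by move=> s; apply: dg; rewrite n_2.
  - by move=> s; apply: dg; rewrite n_2.
  - exact: M0.
  - by move=> s s01; have := g_n s01; rewrite n_2.
  - by rewrite ler01 lexx.
apply: le_trans H _; rewrite mulr2n mulrDl mul1r addrA lerD2r.
have := @derivable1_bound _ (fun t => dirD V [::] [::] (x + t *: w))
  (fun t => dirD V [:: w] [::] (x + t *: w)) M 1.
rewrite /= scale1r scale0r addr0; apply=> //.
- by move=> s; apply: (@is_derive_dirD _ _ V p.+1 [::] [::]).
- move=> s s01; have := @remainder [:: w] s 0 s01; rewrite scale0r addr0; apply.
  + by rewrite normr0.
  + exact: p0.
  + rewrite big_cons big_nil mulr1 /=; apply: (@size_bound _ 1 0 1 (k * delta)) => //.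
    * by rewrite mulr_ge0// ltW.
    * rewrite expr2 ler_wpM2l ?(ltW k0)//.
      rewrite -(@ler_pXn2r _ 2) ?nnegrE// ?(ltW k0)//.
      by move: deltan; rewrite n_2.
    * by apply: le_trans nw _; rewrite -/G !expr1 expr0 mulr1 mulrAC.
- by rewrite ler01 lexx.
Qed.

(** The three copies of [M] pay for the third order remainder in the noise at y, for the second
    order remainder in the drift, and for moving the second order noise term from y back to x. *)
Lemma one_step_pointwise3 : (2 < n)%N ->
  2^-1 * (V (x + w + u) + V (x + w - u)) <=
  V x + (dirD V [:: w] [::] x + 2^-1 * dirD V [:: u; u] [::] x) + 3 * M.
Proof.
move=> n_3.
(* For n = 3 this is the calibrated order itself; for n = 4 the third derivative vanishes at 0 by
   parity and is controlled by the fourth. *)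
have H3 s : 0 <= s <= 1 -> g 3 s <= M.
  have [n_eq3 s01|n_neq3] := eqVneq n 3%N.
    by have := g_n s01; rewrite n_eq3.
  have n_eq4 : n = 4%N by apply/eqP; rewrite eqn_leq n4 ltn_neqAle eq_sym n_neq3.
  move=> s01; have := @derivable1_bound _ (g 3) (g 4) M s.
  rewrite (@g_odd 3 isT) add0r; apply => //.
    by move=> r; apply: dg; rewrite n_eq4.
  by move=> r r01; have := g_n r01; rewrite n_eq4.
have step2 : 2^-1 * (V (x + w + u) + V (x + w - u))
    <= V y + 2^-1 * dirD V [:: u; u] [::] y + M.
  have := @taylor3_bound _ (g 0) (g 1) (g 2) (g 3) M 1.
  rewrite gE (@g_odd 1 isT) mulr0 addr0 expr1n mul1r (@g_even 0 isT) (@g_even 2 isT) /=; apply => //.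
  - by move=> r; apply: dg; apply: leq_trans n_3.
  - by move=> r; apply: dg; apply: leq_trans n_3.
  - by move=> r; apply: dg.
  - by rewrite ler01 lexx.
have p2 : (2 < p)%N by exact: leq_trans np.
(* Moving the second order term along the drift costs k delta^3, which this makes at most k^2. For n
   = 4 it comes from delta^2 <= k. *)
have delta3 : delta ^+ 3 <= k.
  have [n_eq3|n_neq3] := eqVneq n 3%N.
    move: deltan; rewrite n_eq3 => /le_trans; apply.
    by rewrite expr2 ler_piMl// ltW.
  have n_eq4 : n = 4%N by apply/eqP; rewrite eqn_leq n4 ltn_neqAle eq_sym n_neq3.
  have d2 : delta ^+ 2 <= k.
    rewrite -(@ler_pXn2r _ 2) ?nnegrE ?exprn_ge0 ?(ltW k0)//.
    by rewrite -exprM; move: deltan; rewrite n_eq4.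
  by apply: le_trans d2; rewrite exprS ler_piMl// exprn_ge0.
have step1 : V y <= V x + dirD V [:: w] [::] x + M.
  have := @taylor2_bound _ (fun t => dirD V [::] [::] (x + t *: w))
    (fun t => dirD V [:: w] [::] (x + t *: w))
    (fun t => dirD V [:: w; w] [::] (x + t *: w)) M 1.
  rewrite /= scale1r scale0r addr0 mul1r; apply=> //.
  - by move=> s; apply: (@is_derive_dirD _ _ V p.+1 [::] [::]).
  - by move=> s; apply: (@is_derive_dirD _ _ V p.+1 [:: w] [::]).
  - move=> s s01; have := @remainder [:: w; w] s 0 s01; rewrite scale0r addr0; apply.
    + by rewrite normr0.
    + exact: ltnW.
    + rewrite !big_cons big_nil mulr1 /=.
      apply: (@size_bound _ 2 0 2 (k ^+ 2 * delta ^+ 2)) => //.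
      * by rewrite mulr_ge0// exprn_ge0// ltW.
      * by rewrite ler_piMr ?exprn_ge0 ?(ltW k0)// expr_le1.
      * apply: le_trans (ler_pM _ _ nw nw) _; rewrite ?norm1_ge0// -/G.
        by rewrite le_eqVlt; apply/orP; left; apply/eqP; ring.
  - by rewrite ler01 lexx.
have step3 : dirD V [:: u; u] [::] y <= dirD V [:: u; u] [::] x + M.
  have := @derivable1_bound _ (fun t => dirD V [:: u; u] [::] (x + t *: w))
    (fun t => dirD V [:: u; u; w] [::] (x + t *: w)) M 1.
  rewrite /= scale1r scale0r addr0; apply=> //.
  - by move=> s; apply: (@is_derive_dirD _ _ V p.+1 [:: u; u] [::]) => //; exact: ltnW.
  - move=> s s01; have := @remainder [:: u; u; w] s 0 s01; rewrite scale0r addr0.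
    apply.
    + by rewrite normr0.
    + exact: p2.
    + rewrite !big_cons big_nil mulr1 /=.
      apply: (@size_bound _ 3 2 3 (k * delta ^+ 3)) => //.
      * by rewrite mulr_ge0 ?exprn_ge0// ltW.
      * by rewrite expr2 ler_wpM2l// ltW.
      * apply: (@le_trans _ _ ((A * G * (delta * z)) * ((A * G * (delta * z)) * (A * G * (k * delta))))).
          by rewrite !ler_pM ?mulr_ge0 ?norm1_ge0.
        by rewrite le_eqVlt; apply/orP; left; apply/eqP; ring.
  - by rewrite ler01 lexx.
have := M0; move: step1 step2 step3.
move: (V y) (V x) (dirD V [:: w] [::] x) (dirD V [:: u; u] [::] y) => v1 v0 e1 e2.
move: (dirD V [:: u; u] [::] x) (2^-1 * (V _ + V _)) M => e3 v2 M' *; lra.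
Qed.

End one_step_pointwise.

(** * Moments of the normal law *)

Section gaussian.
Context {R : realType}.
Local Notation mu := (@lebesgue_measure R).
Implicit Types (m s a x : R).

(** The change of variables is made with the Radon-Nikodym derivative, which agrees almost
    everywhere with the explicit density because both have the same integral over every measurable
    set. *)
Lemma ge0_integral_normal_prob m s (f : R -> \bar R) :
  measurable_fun [set: R] f -> (forall x, 0 <= f x)%E ->
  (\int[normal_prob m s]_x f x =
   \int[mu]_x (f x * (normal_pdf m s x)%:E))%E.
Proof.
move=> mf f0; have dom := normal_prob_dominates m s.
rewrite -(Radon_Nikodym_SigmaFinite.change_of_variables dom)//.
have ig := Radon_Nikodym_SigmaFinite.f_integrable dom.
have mpdf : measurable_fun [set: R] (fun x => (normal_pdf m s x)%:E).
  by apply/measurable_EFinP; exact: measurable_normal_pdf.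
apply: ae_eq_integral => //.
- by apply: emeasurable_funM => //; exact: measurable_int ig.
- exact: emeasurable_funM.
- apply: ae_eqe_mul2l; apply: integral_ae_eq => //.
  by move=> E _ mE; rewrite -Radon_Nikodym_SigmaFinite.f_integral.
Qed.

(** By uniqueness it suffices to compare the two measures on intervals ]u, v], whose reflections
    [-v, -u[ have the same length. *)
Lemma lebesgue_measureN (A : set R) : measurable A ->
  mu (-%R @^-1` A) = mu A.
Proof.
have mN : measurable_fun [set: measurableTypeR R] (-%R : R -> measurableTypeR R).
  exact: oppr_measurable.
move=> mA.
pose nu : {measure set (measurableTypeR R) -> \bar R} :=
  pushforward mu (-%R : measurableTypeR R -> measurableTypeR R).
apply/esym; apply: (@lebesgue_measure_unique _ (nu mN)) => // _ [[u v] _ <-] /=.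
rewrite /nu /pushforward /=.
have -> : -%R @^-1` `]u, v]%classic = `[- v, - u[%classic.
  by apply/seteqP; split => x /=; rewrite !in_itv/= lerNl ltrNr andbC.
rewrite !lebesgue_measure_itv/= !lte_fin ltrN2.
by case: ifPn => // _; rewrite -!EFinB opprK addrC.
Qed.

Lemma normal_probN s (A : set R) : s != 0 -> measurable A ->
  normal_prob 0 s (-%R @^-1` A) = normal_prob 0 s A.
Proof.
move=> s0 mA; have mN : measurable_fun [set: R] (-%R : R -> R).
  exact: oppr_measurable.
have mpdf : measurable_fun [set: R] (fun x => (normal_pdf 0 s x)%:E).
  by apply/measurable_EFinP; exact: measurable_normal_pdf.
rewrite /normal_prob.
transitivity (\int[mu]_(x in -%R @^-1` A) ((fun x => (normal_pdf 0 s x)%:E) \o -%R) x)%E.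
  apply: eq_integral => x _ /=.
  by rewrite !normal_pdfE// /normal_fun !subr0 sqrrN.
have mN' : measurable_fun [set: measurableTypeR R] (-%R : R -> measurableTypeR R).
  exact: oppr_measurable.
pose nu : {measure set (measurableTypeR R) -> \bar R} :=
  pushforward mu (-%R : measurableTypeR R -> measurableTypeR R).
transitivity (\int[nu mN']_(x in A) (normal_pdf 0 s x)%:E)%E.
  apply/esym; apply: (@ge0_integral_pushforward _ _ _ _ _ _ mN' _ A) => //.
  - exact: measurable_funTS.
  - by move=> x _; rewrite lee_fin normal_pdf_ge0.
apply: (@eq_measure_integral _ (measurableTypeR R) _ A mu (nu mN')) => B mB _.
exact: lebesgue_measureN.
Qed.

Lemma normal_mgf s a : s != 0 ->
  (\int[normal_prob 0 s]_x (expR (a * x))%:E = (expR (a ^+ 2 * s ^+ 2 / 2))%:E)%E.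
Proof.
move=> s0; rewrite ge0_integral_normal_prob//; last first.
  apply/measurable_EFinP; apply: measurableT_comp => //; exact: mulrl_measurable.
(* Completing the square moves the mean of the density to a s^2. *)
transitivity (\int[mu]_x ((expR (a ^+ 2 * s ^+ 2 / 2))%:E *
    (normal_pdf (a * s ^+ 2) s x)%:E))%E.
  apply: eq_integral => x _; rewrite -!EFinM; congr _%:E.
  rewrite !normal_pdfE// /normal_fun mulrCA -expRD [RHS]mulrCA -expRD.
  by congr (_ * expR _); field.
rewrite ge0_integralZl//=; last 2 first.
- by apply/measurable_EFinP; exact: measurable_normal_pdf.
- by move=> x _; rewrite lee_fin normal_pdf_ge0.
by rewrite integral_normal_pdf mule1.
Qed.

Lemma normal_exp_abs s a : s != 0 -> 0 <= a ->
  (\int[normal_prob 0 s]_x (expR (a * `|x|))%:E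
     <= (2 * expR (a ^+ 2 * s ^+ 2 / 2))%:E)%E.
Proof.
move=> s0 a0.
have mexp b : measurable_fun [set: measurableTypeR R]
    (fun x : measurableTypeR R => (expR (b * x))%:E).
  apply/measurable_EFinP; apply: measurableT_comp => //; exact: mulrl_measurable.
apply: (@le_trans _ _ (\int[normal_prob 0 s]_x ((expR (a * x))%:E + (expR (- a * x))%:E)))%E.
  apply: ge0_le_integral => //.
  - apply/measurable_EFinP; apply: measurableT_comp => //.
    by apply: measurable_funM => //; exact: measurableT_comp.
  - exact: (emeasurable_funD (mexp a) (mexp (- a))).
  - move=> x _; rewrite -EFinD lee_fin mulNr -mulrN.
    have [x0|x0] := leP 0 x.
      by rewrite ger0_norm// lerDl expR_ge0.
    by rewrite ltr0_norm// lerDr expR_ge0.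
rewrite ge0_integralD//.
by rewrite !normal_mgf// sqrrN -EFinD lee_fin mulr2n mulrDl mul1r.
Qed.

End gaussian.

Section gaussian_variance.
Context {R : realType}.
Implicit Types (s a x y : R).

Lemma expR_taylor3 y :
  `|expR y - (1 + y + y ^+ 2 / 2)| <= `|y| ^+ 3 * expR `|y|.
Proof.
pose f k (t : R) := y ^+ k * expR (t * y).
have df k (t : R) : is_derive t 1 (f k) (f k.+1 t).
  have dm : is_derive t 1 (fun r : R => r * y) y.
    by apply: is_derive_eq; rewrite scaler0 add0r; exact: mulr1.
  have de := @is_derive1_comp _ expR (fun r : R => r * y) t _ _ (is_derive_expR _) dm.
  have -> : f k = y ^+ k \*: (expR \o (fun r : R => r * y)) by [].
  have -> : f k.+1 t = y ^+ k *: (expR (t * y) * y).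
    by rewrite /f exprS /GRing.scale/=; ring.
  exact: is_deriveZ.
pose M := `|y| ^+ 3 * expR `|y|.
have M0 : 0 <= M by rewrite mulr_ge0 ?exprn_ge0 ?expR_ge0.
have fM (t : R) : 0 <= t <= 1 -> `|f 3 t| <= M.
  move=> /andP[t0 t1]; rewrite /f normrM normrX (ger0_norm (expR_ge0 _)).
  rewrite /M ler_wpM2l ?exprn_ge0// ler_expR (le_trans (ler_norm _))//.
  by rewrite normrM (ger0_norm t0) ler_piMl.
have o1 : 0 <= (1 : R) <= 1 by rewrite ler01 lexx.
rewrite ler_norml; apply/andP; split.
- have dg k (t : R) : is_derive t 1 (fun t => - f k t) (- f k.+1 t).
    exact: is_deriveN.
  have := taylor3_bound (dg 0%N) (dg 1%N) (dg 2%N) M0 _ o1.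
  rewrite /f mul0r mul1r !expr0 expR0 expr1n expr1 !mul1r !mulr1 => H.
  rewrite -/M; suff : - expR y <= -1 - y + 2^-1 * - y ^+ 2 + M by lra.
  by apply: H => t t01; rewrite lerNl; have := fM t t01; rewrite ler_norml => /andP[].
- have := taylor3_bound (df 0%N) (df 1%N) (df 2%N) M0 _ o1.
  rewrite /f mul0r mul1r !expr0 expR0 expr1n expr1 !mul1r !mulr1 => H.
  rewrite -/M; suff : expR y <= 1 + y + 2^-1 * y ^+ 2 + M by lra.
  by apply: H => t t01; have := fM t t01; rewrite ler_norml => /andP[].
Qed.

(** Since |t|^3 <= exp(3 |t|), the error is a^3 times a function of t with finite Gaussian integral,
    of smaller order than the term a^2 t^2 to be isolated. *)
Lemma cosh_taylor (a t : R) : 0 <= a <= 1 ->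
  `|expR (a * t) + expR (- a * t) - (2 + a ^+ 2 * t ^+ 2)|
  <= 2 * a ^+ 3 * expR (4 * `|t|).
Proof.
move=> /andP[a0 a1].
have H : `|a * t| ^+ 3 * expR `|a * t| <= a ^+ 3 * expR (4 * `|t|).
  rewrite normrM (ger0_norm a0) exprMn -mulrA ler_wpM2l ?exprn_ge0//.
  have -> : 4 * `|t| = 3%:R * `|t| + `|t| by ring.
  rewrite expRD expRM_natl ler_pM ?exprn_ge0 ?expR_ge0//.
    rewrite lerXn2r ?nnegrE ?expR_ge0//.
    by rewrite (le_trans _ (expR_ge1Dx _))// lerDr.
  by rewrite ler_expR ler_piMl.
have := expR_taylor3 (a * t); have := expR_taylor3 (- a * t).
rewrite mulNr normrN !ler_norml => /andP[A1 A2] /andP[B1 B2].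
apply/andP; split; nra.
Qed.

(* Evaluating the moment generating function at [a / |s|] and [- a / |s|] and
   expanding cosh squeezes the second moment as [a] tends to [0]. *)
Lemma normal_second_moment s : s != 0 ->
  (\int[normal_prob 0 s]_x (x ^+ 2)%:E = (s ^+ 2)%:E)%E.
Proof.
move=> s0; pose nu := normal_prob 0 s.
have mexp b : measurable_fun [set: measurableTypeR R]
    (fun x : measurableTypeR R => (expR (b * x))%:E).
  by apply/measurable_EFinP; apply: measurableT_comp => //; exact: mulrl_measurable.
have mabs b : measurable_fun [set: measurableTypeR R]
    (fun x : measurableTypeR R => (expR (b * `|x|))%:E).
  apply/measurable_EFinP; apply: measurableT_comp => //.
  by apply: measurable_funM => //; exact: measurableT_comp.
have msq : measurable_fun [set: measurableTypeR R]
    (fun x : measurableTypeR R => (x ^+ 2)%:E).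
  by apply/measurable_EFinP; exact: exprn_measurable.
have sn0 : 0 < `|s| by rewrite normr_gt0.
pose lam := 4 / `|s|.
have Cfin : (\int[nu]_x (expR (lam * `|x|))%:E < +oo)%E.
  apply: le_lt_trans (normal_exp_abs s0 _) (ltry _).
  by rewrite divr_ge0.
have C0 : (0 <= \int[nu]_x (expR (lam * `|x|))%:E)%E.
  by apply: integral_ge0 => x _; rewrite lee_fin expR_ge0.
have CE : (\int[nu]_x (expR (lam * `|x|))%:E)%E \is a fin_num.
  by rewrite ge0_fin_numE.
set C := fine (\int[nu]_x (expR (lam * `|x|))%:E)%E.
have CEq : (\int[nu]_x (expR (lam * `|x|))%:E)%E = C%:E by rewrite fineK.
have C00 : 0 <= C by rewrite fine_ge0.
have E0 : (0 <= \int[nu]_x (x ^+ 2)%:E)%E.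
  by apply: integral_ge0 => x _; rewrite lee_fin sqr_ge0.
have pt a x : 0 <= a <= 1 ->
    `|expR (a / `|s| * x) + expR (- (a / `|s|) * x) - (2 + (a / `|s|) ^+ 2 * x ^+ 2)|
  <= 2 * a ^+ 3 * expR (lam * `|x|).
  move=> a01; have := @cosh_taylor a (x / `|s|) a01.
  rewrite normrM normfV (ger0_norm (ltW sn0)).
  have -> : a * (x / `|s|) = a / `|s| * x by rewrite mulrA mulrAC.
  have -> : - a * (x / `|s|) = - (a / `|s|) * x by rewrite !mulNr mulrA mulrAC.
  have -> : 4 * (`|x| / `|s|) = lam * `|x| by rewrite /lam mulrA mulrAC.
  have -> // : a ^+ 2 * (x / `|s|) ^+ 2 = (a / `|s|) ^+ 2 * x ^+ 2.
  by rewrite -!exprMn mulrA mulrAC.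
have mgf2 a : (\int[nu]_x ((expR (a / `|s| * x))%:E + (expR (- (a / `|s|) * x))%:E)
   = (2 * expR (a ^+ 2 / 2))%:E)%E.
  rewrite ge0_integralD//.
  rewrite !normal_mgf// sqrrN -EFinD expr_div_n real_normK ?num_real//.
  rewrite divfK ?expf_neq0//; congr _%:E; ring.
have i2 a : (\int[nu]_x (2%:E + ((a / `|s|) ^+ 2)%:E * (x ^+ 2)%:E)
   = 2%:E + ((a / `|s|) ^+ 2)%:E * \int[nu]_x (x ^+ 2)%:E)%E.
  rewrite ge0_integralD//; last 2 first.
  - by move=> x _; rewrite mule_ge0 ?lee_fin ?sqr_ge0.
  - exact: emeasurable_funM.
  rewrite integral_cst// [X in (2%:E * X)%E](_ : _ = 1%E); last first.
    exact: probability_setT.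
  rewrite mule1; congr (_ + _)%E.
  by rewrite ge0_integralZl// => *; rewrite lee_fin sqr_ge0.
have mcosh a : measurable_fun [set: measurableTypeR R] (fun x : measurableTypeR R =>
    ((expR (a / `|s| * x))%:E + (expR (- (a / `|s|) * x))%:E)%E).
  exact: (emeasurable_funD (mexp _) (mexp _)).
have mq a : measurable_fun [set: measurableTypeR R] (fun x : measurableTypeR R =>
    (2%:E + ((a / `|s|) ^+ 2)%:E * (x ^+ 2)%:E)%E).
  by apply: emeasurable_funD => //; exact: emeasurable_funM.
have mr a : measurable_fun [set: measurableTypeR R] (fun x : measurableTypeR R =>
    ((2 * a ^+ 3)%:E * (expR (lam * `|x|))%:E)%E).
  exact: emeasurable_funM.
have q0 a x : (0 <= 2%:E + ((a / `|s|) ^+ 2)%:E * (x ^+ 2)%:E)%E.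
  by rewrite -EFinM -EFinD lee_fin addr_ge0// mulr_ge0 ?sqr_ge0.
have ch0 a x : (0 <= (expR (a / `|s| * x))%:E + (expR (- (a / `|s|) * x))%:E)%E.
  by rewrite adde_ge0// lee_fin expR_ge0.
have r0 a x : 0 <= a -> (0 <= (2 * a ^+ 3)%:E * (expR (lam * `|x|))%:E)%E.
  by move=> a0; rewrite mule_ge0// lee_fin ?mulr_ge0 ?exprn_ge0 ?expR_ge0.
have ir a : 0 <= a -> (\int[nu]_x ((2 * a ^+ 3)%:E * (expR (lam * `|x|))%:E)
    = (2 * a ^+ 3 * C)%:E)%E.
  by move=> a0; rewrite ge0_integralZl// ?CEq// lee_fin mulr_ge0// exprn_ge0.
(* [up] and [lo] compare integrals of nonnegative functions, the negative terms having been moved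
   across, so they hold before the second moment is known to be finite. *)
have up a : 0 <= a <= 1 ->
   (2%:E + ((a / `|s|) ^+ 2)%:E * \int[nu]_x (x ^+ 2)%:E
   <= (2 * expR (a ^+ 2 / 2) + 2 * a ^+ 3 * C)%:E)%E.
  move=> a01; have a0 : 0 <= a by case/andP: a01.
  rewrite -i2 [leRHS]EFinD -mgf2 -ir// -ge0_integralD//; do ?by move=> x _; exact: r0.
  apply: ge0_le_integral => //.
    exact: emeasurable_funD.
  move=> x _; rewrite -!EFinM -!EFinD lee_fin.
  by have := pt a x a01; rewrite ler_norml => /andP[]; lra.
have lo a : 0 <= a <= 1 ->
   ((2 * expR (a ^+ 2 / 2))%:E <=
   2%:E + ((a / `|s|) ^+ 2)%:E * \int[nu]_x (x ^+ 2)%:E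
   + (2 * a ^+ 3 * C)%:E)%E.
  move=> a01; have a0 : 0 <= a by case/andP: a01.
  rewrite -i2 -mgf2 -ir// -ge0_integralD//; do ?by move=> x _; exact: r0.
  apply: ge0_le_integral => //.
    exact: emeasurable_funD.
  move=> x _; rewrite -!EFinM -!EFinD lee_fin.
  by have := pt a x a01; rewrite ler_norml => /andP[]; lra.
have Efin : (\int[nu]_x (x ^+ 2)%:E)%E \is a fin_num.
  rewrite ge0_fin_numE// ltey; apply/negP => /eqP Ey.
  have := up 1; rewrite ler01 lexx => /(_ isT); rewrite Ey.
  rewrite gt0_muley ?addey// lte_fin exprn_gt0// divr_gt0//.
rewrite -(fineK Efin); congr _%:E.
move: up lo; rewrite -(fineK Efin); set e := fine _ => up lo.
(* Up to the factor a^3, the three terms bound the integrated cosh error, the quadratic term of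
   exp(a^2 / 2) and its cubic remainder, the last two counted twice. *)
pose D := 2 * C + 2 + 2 * expR 1.
have D0 : 0 < D by rewrite /D; have := expR_gt0 (1 : R); lra.
have key a : 0 < a <= 1 -> `|1 - e / s ^+ 2| <= a * D.
  move=> /andP[a0 a1]; have a01 : 0 <= a <= 1 by rewrite ltW.
  have := up a a01; have := lo a a01.
  rewrite -!EFinM -!EFinD !lee_fin.
  have -> : (a / `|s|) ^+ 2 * e = a ^+ 2 * (e / s ^+ 2).
    by rewrite expr_div_n real_normK ?num_real// mulrA mulrAC.
  set t := e / _ => L U.
  set y := a ^+ 2 / 2 in L U.
  have y0 : 0 <= y by rewrite /y divr_ge0// sqr_ge0.
  have a21 : a ^+ 2 <= 1 by rewrite expr_le1// ltW.
  have y1 : y <= 1 by rewrite /y; lra.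
  have := expR_taylor3 y; rewrite (ger0_norm y0).
  have ey : expR y <= expR 1 by rewrite ler_expR.
  have y3 : y ^+ 3 * expR y <= a ^+ 3 * expR 1.
    apply: ler_pM; rewrite ?exprn_ge0 ?expR_ge0// lerXn2r ?nnegrE//.
      exact: ltW.
    rewrite /y expr2; have : a * a <= a by rewrite ler_piMl// ltW.
    have := a0; lra.
  have y2 : y ^+ 2 / 2 <= a ^+ 3.
    have -> : y ^+ 2 / 2 = a ^+ 3 * (a / 8) by rewrite /y; field.
    by rewrite ler_piMr ?exprn_ge0 ?(ltW a0)//; lra.
  have y20 : 0 <= y ^+ 2 by exact: sqr_ge0.
  have ay : 2 * y = a ^+ 2 by rewrite /y; field.
  rewrite ler_norml => /andP[A1 A2].
  rewrite -(ler_pM2l (exprn_gt0 2 a0)) -{1}(ger0_norm (sqr_ge0 a)) -normrM.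
  have -> : a ^+ 2 * (a * D) = a ^+ 3 * D by ring.
  rewrite /D ler_norml; apply/andP; split; lra.
have e1 : e / s ^+ 2 = 1.
  apply/eqP; rewrite eq_sym -subr_eq0 -normr_eq0 eq_le normr_ge0 andbT leNgt.
  apply/negP => dgt0; set del := `|_| in dgt0 key.
  (* This value of [a] lies in ]0, 1] and makes [a * D] smaller than [del]. *)
  have := key (del / (del + 2 * D)).
  have dD : 0 < del + 2 * D by lra.
  rewrite divr_gt0// ler_pdivrMr// mul1r lerDl => /(_ _).
  have D2 : 0 <= 2 * D by lra.
  move=> /(_ D2); rewrite mulrAC ler_pdivlMr// => ?; nra.
by rewrite -[LHS](@divfK _ (s ^+ 2)) ?expf_neq0// e1 mul1r.
Qed.

End gaussian_variance.

(** * Borel sets of R^m and Gaussian increments *)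

Local Notation borelV R m := (g_sigma_algebraType (@open 'cV[R]_m)).

Section borelV.
Context {R : realType}.

(** An open set is the union of the boxes with rational centre and radius 1/(n+1) that it contains.
    These are enumerated by their codes; [F k] is empty when [k] encodes no such box. *)
Lemma measurable_coordwise dd (T : measurableType dd) m (f : T -> 'cV[R]_m) :
  (forall i, measurable_fun setT (fun t => f t i 0)) ->
  measurable_fun setT (f : T -> borelV R m).
Proof.
move=> mf; apply: (@measurability _ _ _ (borelV R m) _ _ (@open 'cV[R]_m)) => [//|_ [U oU <-]].
rewrite setTI.
pose box (qn : {ffun 'I_m -> rat} * nat) : set 'cV[R]_m :=
  [set x | forall i, `|x i 0 - ratr (qn.1 i)| < qn.2.+1%:R^-1].
pose F (k : nat) : set T :=
  if unpickle k is Some qn then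
    if `[< box qn `<=` U >] then f @^-1` box qn else set0 else set0.
have -> : f @^-1` U = \bigcup_k F k.
  apply/seteqP; split=> [t /= Ut|t [k _]]; last first.
    rewrite /F; case: unpickle => // qn; case: asboolP => // sub; exact: sub.
  have [e /= e0 be] : exists2 e : R, 0 < e & ball (f t) e `<=` U.
    by have /nbhs_ballP[e e0 be] : nbhs (f t) U; [exact: open_nbhs_nbhs|exists e].
  (* Half of [e], because a point of the box is only within two radii of [f t]. *)
  have [n nE] : exists n : nat, n.+1%:R^-1 < e / 2.
    have e20 : 0 < e / 2 by rewrite divr_gt0.
    have [n _ /(_ n (leqnn n)) nE] := near_infty_natSinv_lt (PosNum e20).
    by exists n.
  have qP i : exists q : rat, `|f t i 0 - ratr q| < n.+1%:R^-1.
    have : f t i 0 - n.+1%:R^-1 < f t i 0 + n.+1%:R^-1.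
      by rewrite ltrBlDr -addrA ltrDl addr_gt0// invr_gt0.
    move=> /rat_in_itvoo[q]; rewrite in_itv/= => /andP[q1 q2].
    exists q; move: q1 q2; move: (ratr q) (n.+1%:R^-1) => u v q1 q2.
    by rewrite ltr_norml; apply/andP; split; lra.
  pose q := [ffun i => projT1 (cid (qP i))].
  have tq : box (q, n) (f t).
    by move=> i /=; rewrite ffunE; exact: (projT2 (cid (qP i))).
  exists (pickle (q, n)) => //; rewrite /F pickleK.
  case: asboolP => // -[] y yq; apply: be; split => // i j; rewrite ord1.
  rewrite /ball/=; have := tq i; have := yq i; rewrite /= => A1 A2.
  rewrite (_ : f t i 0 - y i 0 = (f t i 0 - ratr (q i)) - (y i 0 - ratr (q i))); last by ring.
  apply: le_lt_trans (ler_normB _ _) _; apply: lt_trans (ltrD A2 A1) _.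
  by rewrite [ltRHS]splitr ltrD.
apply: bigcupT_measurable => k; rewrite /F.
case: unpickle => [qn|]; last exact: measurable0.
case: asboolP => _; last exact: measurable0.
have -> : f @^-1` box qn = \bigcap_(i in [set: 'I_m])
    ((fun t => f t i 0) @^-1` (ball (ratr (qn.1 i) : R) qn.2.+1%:R^-1)).
  apply/seteqP; split => t /= H i; first by move=> _; rewrite /ball/= distrC; exact: H.
  by have := H i I; rewrite /ball/= distrC.
apply: fin_bigcap_measurable => [|i _]; first exact: finite_finset.
by rewrite -[X in measurable X]setTI; apply: mf => //; exact: measurable_ball.
Qed.

Lemma continuous_measurableV m (g : 'cV[R]_m -> R) :
  continuous g -> measurable_fun setT (g : borelV R m -> R).
Proof.
move=> /continuousP cg; apply: (measurability _ (RGenOpens.measurableE R)).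
move=> _ [_ [a [b ->] <-]]; rewrite setTI; apply: sub_sigma_algebra.
exact/cg/interval_open.
Qed.

Lemma measurable_coordV m (i : 'I_m) :
  measurable_fun setT (fun x : borelV R m => (x : 'cV[R]_m) i 0).
Proof. apply: continuous_measurableV; exact: coord_continuous. Qed.

Definition boxes m : set (set 'cV[R]_m) :=
  [set [set x : 'cV[R]_m | forall i, B i (x i 0)] |
    B in [set B : 'I_m -> set R | forall i, measurable (B i)]].

Arguments boxes m : clear implicits.

Lemma measurable_box m (B : 'I_m -> set R) : (forall i, measurable (B i)) ->
  measurable ([set x | forall i, B i (x i 0)] : set (borelV R m)).
Proof.
move=> mB.
set A := (A in measurable A); have -> : A =
    \bigcap_(i in [set: 'I_m]) ((fun x : borelV R m => (x : 'cV[R]_m) i 0) @^-1` (B i)).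
  by apply/seteqP; split => x /= H i; [move=> _; exact: H|exact: (H i I)].
apply: fin_bigcap_measurable => [|i _]; first exact: finite_finset.
rewrite -[X in measurable X]setTI; apply: measurable_coordV => //.
Qed.

(** For the inclusion of the Borel sets, the identity from the columns with the sigma-algebra of
    boxes to the Borel columns is measurable coordinate by coordinate. *)
Lemma sigma_boxes m : (measurable : set (set (borelV R m))) = <<s boxes m >>.
Proof.
apply/seteqP; split.
- pose T := g_sigma_algebraType (boxes m).
  have mid : measurable_fun setT (fun x : T => x : borelV R m).
    apply: measurable_coordwise => i _ B mB; rewrite setTI.
    apply: sub_sigma_algebra.
    exists (fun j => if j == i then B else setT).
      by move=> j; case: ifP.
    apply/seteqP; split => x /= => [/(_ i)|Bx j]; first by rewrite eqxx.
    by case: eqP => // ->.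
  by move=> A mA; have := mid measurableT A mA; rewrite setTI.
- apply: smallest_sub; first exact: sigma_algebra_measurable.
  by move=> _ [B mB <-]; exact: measurable_box.
Qed.

(** Boxes are stable under intersection and include the whole space, so they determine a finite
    measure. This exploits a Gaussian law given only by its values on boxes. *)
Lemma boxes_unique m (m1 m2 : {measure set (borelV R m) -> \bar R}) :
  (m1 setT < +oo)%E ->
  (forall B : 'I_m -> set R, (forall i, measurable (B i)) ->
    m1 [set x | forall i, B i ((x : 'cV[R]_m) i 0)] =
    m2 [set x | forall i, B i ((x : 'cV[R]_m) i 0)]) ->
  forall A, measurable A -> m1 A = m2 A.
Proof.
move=> m1T m12 A mA.
have bT : boxes m setT.
  by exists (fun=> setT) => //; apply/seteqP; split.
apply: (@measure_unique _ R (borelV R m) (boxes m) (fun=> setT)) => //.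
- exact: sigma_boxes.
- move=> _ _ [B mB <-] [C mC <-]; exists (fun i => B i `&` C i).
    by move=> i; exact: measurableI.
  apply/seteqP; split => x /= => [H|[H1 H2] i]; last by split.
  by split => i; have [] := H i.
- by rewrite bigcup_const//; exists 0%N.
- by move=> _ [B mB <-]; exact: m12.
Qed.

End borelV.

Lemma ge0_integral_law {R : realType} d d' (T : measurableType d)
    (T' : measurableType d') (Q : {measure set T -> \bar R})
    (Q' : {measure set T' -> \bar R}) (phi : T -> T') (f : T' -> \bar R) :
  measurable_fun setT phi ->
  (forall A, measurable A -> Q (phi @^-1` A) = Q' A) ->
  measurable_fun setT f -> (forall y, 0 <= f y)%E ->
  (\int[Q]_x f (phi x) = \int[Q']_y f y)%E.
Proof.
move=> mphi QQ' mf f0.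
pose nu : {measure set T' -> \bar R} := pushforward Q phi.
transitivity (\int[nu mphi]_y f y)%E.
  by rewrite [RHS]ge0_integral_pushforward.
by apply: eq_measure_integral => A mA _; exact: QQ'.
Qed.

(** * Integrals with respect to a Gaussian law on columns *)

Section gaussian_law.
Context {R : realType} {m : nat}.
Variables (s : R) (Q : {measure set (borelV R m) -> \bar R}).
Hypothesis s_gt0 : 0 < s.
Hypothesis Qbox : forall B : 'I_m -> set R, (forall i, measurable (B i)) ->
  Q [set x | forall i, B i ((x : 'cV[R]_m) i 0%R)]
  = (\prod_(i < m) normal_prob 0 s (B i))%E.

Let s0 : s != 0. Proof. by rewrite gt_eqF. Qed.

Lemma gaussian_law_setT : Q setT = 1%E.
Proof.
have -> : [set: borelV R m] = [set x | forall i, setT ((x : 'cV[R]_m) i 0%R)].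
  by apply/seteqP; split.
rewrite (Qbox (B := fun=> setT))//; apply: big1 => i _.
exact: probability_setT.
Qed.

Lemma gaussian_law_coord (i : 'I_m) (g : R -> \bar R) :
  measurable_fun [set: R] g -> (forall x, 0 <= g x)%E ->
  (\int[Q]_x g ((x : 'cV[R]_m) i 0%R) = \int[normal_prob 0 s]_x g x)%E.
Proof.
move=> mg g0.
apply: (@ge0_integral_law _ _ _ _ _ Q (normal_prob 0 s) (fun x : borelV R m => (x : 'cV[R]_m) i 0%R)) => //.
  exact: measurable_coordV.
move=> A mA.
have -> : (fun x : borelV R m => (x : 'cV[R]_m) i 0%R) @^-1` A =
  [set x | forall j, (if j == i then A else setT) ((x : 'cV[R]_m) j 0%R)].
  apply/seteqP; split => x /= => [Ax j|/(_ i)]; last by rewrite eqxx.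
  by case: eqP => // ->.
rewrite (Qbox (B := fun j => if j == i then A else setT)); last first.
  by move=> j; case: ifP.
rewrite (bigD1 i)//= eqxx big1 ?mule1// => j /negbTE ->.
exact: probability_setT.
Qed.

(** Sign changes of selected coordinates: flipping all of them symmetrises the noise, flipping a
    single one makes the mixed second moments vanish. *)
Definition flip (e : 'I_m -> bool) (x : 'cV[R]_m) : 'cV[R]_m :=
  \col_i ((-1) ^+ e i * x i 0).

Lemma measurable_flip e :
  measurable_fun setT (flip e : borelV R m -> borelV R m).
Proof.
apply: measurable_coordwise => i.
have -> : (fun x : borelV R m => flip e x i 0) = (fun x : borelV R m => (-1) ^+ e i * (x : 'cV[R]_m) i 0%R).
  by apply/funext => x; rewrite mxE.
by apply: measurable_funM => //; exact: measurable_coordV.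
Qed.

Lemma gaussian_law_flip e (f : borelV R m -> \bar R) :
  measurable_fun setT f -> (forall x, 0 <= f x)%E ->
  (\int[Q]_x f (flip e x) = \int[Q]_x f x)%E.
Proof.
move=> mf f0; have mfl := measurable_flip e.
pose nu : {measure set (borelV R m) -> \bar R} :=
  pushforward Q (flip e : borelV R m -> borelV R m).
apply: (@ge0_integral_law _ _ _ _ _ Q Q (flip e : borelV R m -> borelV R m)) => //.
apply: (@boxes_unique _ _ (nu mfl) Q).
  by rewrite [X in (X < _)%E](_ : _ = 1%E) ?ltry//; exact: gaussian_law_setT.
move=> B mB; rewrite /nu /pushforward /=.
have mB' i : measurable (if e i then -%R @^-1` (B i) else B i).
  case: ifP => // _; rewrite -[X in measurable X]setTI.
  by apply: oppr_measurable.
transitivity (Q [set x | forall i,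
    (if e i then -%R @^-1` (B i) else B i) ((x : 'cV[R]_m) i 0%R)]).
  congr (Q _); apply/seteqP; split => x /= H i; have := H i; rewrite mxE;
    case: (e i) => /=; by rewrite ?mulN1r ?mul1r.
rewrite (Qbox (B := fun i => if e i then -%R @^-1` (B i) else B i))// Qbox//.
apply: eq_bigr => i _; case: ifP => // _.
exact: normal_probN.
Qed.

Lemma flipT x : flip (fun=> true) x = - x.
Proof. by apply/colP => i; rewrite !mxE expr1 mulN1r. Qed.

Let mcoord i : measurable_fun setT (fun x : borelV R m => (x : 'cV[R]_m) i 0%R).
Proof. exact: measurable_coordV. Qed.

Lemma integral_coord_sqr i :
  (\int[Q]_x (((x : 'cV[R]_m) i 0%R) ^+ 2)%:E = (s ^+ 2)%:E)%E.
Proof.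
rewrite (@gaussian_law_coord i (fun x => (x ^+ 2)%:E)).
- exact: normal_second_moment.
- by apply/measurable_EFinP; exact: exprn_measurable.
- by move=> x; rewrite lee_fin sqr_ge0.
Qed.

Lemma integrable_coord_sqr i :
  Q.-integrable setT (fun x => (((x : 'cV[R]_m) i 0%R) ^+ 2)%:E).
Proof.
apply/integrableP; split.
  by apply/measurable_EFinP; apply: measurable_funX; exact: mcoord.
under eq_integral do rewrite gee0_abs ?lee_fin ?sqr_ge0//.
by rewrite integral_coord_sqr ltry.
Qed.

Lemma integrable_coordM i j :
  Q.-integrable setT (fun x => ((x : 'cV[R]_m) i 0%R * (x : 'cV[R]_m) j 0%R)%:E).
Proof.
apply: (le_integrable measurableT _ _
  (integrableD measurableT (integrable_coord_sqr i) (integrable_coord_sqr j))).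
  by apply/measurable_EFinP; apply: measurable_funM; exact: mcoord.
move=> x _; rewrite -EFinD !abse_EFin lee_fin.
rewrite [leRHS]ger0_norm ?addr_ge0 ?sqr_ge0// ler_norml; apply/andP; split; nra.
Qed.

Lemma integral_coordM i j :
  (\int[Q]_x ((x : 'cV[R]_m) i 0%R * (x : 'cV[R]_m) j 0%R)%:E
   = ((i == j)%:R * s ^+ 2)%:E)%E.
Proof.
have [<-|ij] := eqVneq i j.
  rewrite mul1r -(integral_coord_sqr i); apply: eq_integral => x _.
  by rewrite expr2.
rewrite mul0r.
pose f (x : borelV R m) := ((x : 'cV[R]_m) i 0%R * (x : 'cV[R]_m) j 0%R)%:E.
have intf : Q.-integrable setT f by exact: integrable_coordM.
have mf := measurable_int _ intf.
(* Flipping coordinate [i] alone reverses the sign of the product and so exchanges its positive and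
   negative parts. *)
pose e k := k == i.
have fe x : (f (flip e x) = - f x)%E.
  by rewrite /f !mxE /e eqxx eq_sym (negbTE ij) expr1 expr0 mulN1r mul1r mulNr EFinN.
rewrite -/f integralE.
have -> : (\int[Q]_x f^\- x = \int[Q]_x f^\+ x)%E.
  rewrite -(@gaussian_law_flip e f^\+)%E//; last exact: measurable_funepos.
  by apply: eq_integral => x _; rewrite funenegE funeposE fe.
rewrite subee//; apply: integral_fune_fin_num => //.
exact: integrable_funepos.
Qed.

(** Bounding [norm1 x] by m times the largest |x_i| reduces to one-dimensional exponential moments.
    The summand 1 covers m = 0, where there is no largest coordinate. *)
Lemma integral_exp_norm1 (a : R) : 0 <= a ->
  (\int[Q]_x (expR (a * (norm1 (x : 'cV[R]_m) / s)))%:E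
   <= (1 + m%:R * (2 * expR ((m%:R * a) ^+ 2 / 2)))%:E)%E.
Proof.
move=> a0.
have mE (b : R) : measurable_fun [set: R] (fun x : R => (expR (b * `|x|))%:E).
  apply/measurable_EFinP; apply: measurableT_comp => //.
  by apply: measurable_funM => //; exact: measurableT_comp.
have mEi (b : R) i : measurable_fun setT
    (fun x : borelV R m => (expR (b * `|(x : 'cV[R]_m) i 0%R|))%:E).
  by apply: (measurableT_comp (mE b)); exact: mcoord.
pose b := m%:R * a / s.
have b0 : 0 <= b by rewrite divr_ge0 ?mulr_ge0// ltW.
have pt (x : 'cV[R]_m) :
    expR (a * (norm1 x / s)) <= 1 + \sum_i expR (b * `|x i 0|).
  have [i0 ile] : exists i0 : option 'I_m,
     norm1 x <= m%:R * (if i0 is Some i then `|x i 0| else 0).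
    case: (posnP m) => [m0|m0].
      exists None; rewrite mulr0 /norm1 big1// => i _.
      by have := ltn_ord i; rewrite {2}m0.
    pose i1 : 'I_m := Ordinal m0.
    have [i _ iP] := arg_maxP (fun i => `|x i 0|) (P := xpredT) (i0 := i1) isT.
    exists (Some i); rewrite /norm1 (le_trans (ler_sum _ (fun j _ => iP j isT)))//.
    by rewrite sumr_const card_ord mulr_natl.
  have S0 : 0 <= \sum_i expR (b * `|x i 0|) by apply: sumr_ge0 => i _; exact: expR_ge0.
  case: i0 ile => [i|] ile.
    apply: (@le_trans _ _ (expR (b * `|x i 0|))); last first.
      rewrite (bigD1 i)//= addrCA lerDl addr_ge0//.
      by apply: sumr_ge0 => j _; exact: expR_ge0.
    rewrite ler_expR (_ : b * _ = a * (m%:R * `|x i 0| / s)); last first.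
      by rewrite /b; ring.
    by rewrite ler_wpM2l// ler_pM2r ?invr_gt0.
  rewrite mulr0 in ile.
  have -> : norm1 x = 0 by apply/eqP; rewrite eq_le ile norm1_ge0.
  by rewrite mul0r mulr0 expR0 lerDl.
apply: (@le_trans _ _ (\int[Q]_x (1 + \sum_i (expR (b * `|(x : 'cV[R]_m) i 0%R|))%:E))%E).
  apply: ge0_le_integral => //.
  - apply/measurable_EFinP; apply: measurableT_comp => //.
    apply: measurable_funM => //; apply: measurable_funM => //; rewrite /norm1.
    apply: measurable_sum => i; apply: measurableT_comp => //; exact: mcoord.
  - by apply: emeasurable_funD => //; apply: emeasurable_sum.
  - by move=> x _; rewrite sumEFin -EFinD lee_fin.
rewrite ge0_integralD//; last 2 first.
- by move=> x _; apply: sume_ge0 => i _; rewrite lee_fin expR_ge0.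
- exact: emeasurable_sum.
rewrite integral_cst// gaussian_law_setT mule1 EFinD leeD2l//.
rewrite ge0_integral_sum//.
apply: (@le_trans _ _ (\sum_(i < m) (2 * expR ((m%:R * a) ^+ 2 / 2))%:E)%E); last first.
  by rewrite sumEFin sumr_const card_ord -[X in (X%:E <= _)%E]mulr_natl.
apply: lee_sum => i _.
rewrite (@gaussian_law_coord i (fun x => (expR (b * `|x|))%:E))//.
apply: le_trans (normal_exp_abs s0 b0) _.
by rewrite /b expr_div_n divfK ?expf_neq0.
Qed.

End gaussian_law.

(** * One step of the scheme *)

Lemma hs_norm_entry {R : realType} {m n : nat} (A : 'M[R]_(m, n)) i j :
  `|A i j| <= hs_norm A.
Proof.
rewrite -sqrtr_sqr /hs_norm ler_wsqrtr// (bigD1 i)//= (bigD1 j)//= -addrA lerDl.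
by rewrite addr_ge0// sumr_ge0// => k _; rewrite ?sumr_ge0// => *; exact: sqr_ge0.
Qed.

Lemma norm1_hs_norm {R : realType} {d : nat} (x : 'cV[R]_d) :
  norm1 x <= d%:R * hs_norm x.
Proof.
rewrite (le_trans (ler_sum _ (fun i _ => hs_norm_entry x i 0)))//.
by rewrite sumr_const card_ord mulr_natl.
Qed.

Lemma norm1_mulmx {R : realType} {d m : nat} (A : 'M[R]_(d, m)) (e : 'cV[R]_m) :
  norm1 (A *m e) <= d%:R * hs_norm A * norm1 e.
Proof.
rewrite (@le_trans _ _ (\sum_(i < d) hs_norm A * norm1 e))//; last first.
  by rewrite sumr_const card_ord -[leLHS]mulr_natl mulrA.
apply: ler_sum => i _; rewrite mxE (le_trans (ler_norm_sum _ _ _))//.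
rewrite mulr_sumr; apply: ler_sum => j _.
by rewrite normrM ler_wpM2r// hs_norm_entry.
Qed.

Section gaussian_quadratic.
Context {R : realType} {m : nat}.
Variables (s : R) (Q : {measure set (borelV R m) -> \bar R}).
Hypothesis s_gt0 : 0 < s.
Hypothesis Qbox : forall B : 'I_m -> set R, (forall i, measurable (B i)) ->
  Q [set x | forall i, B i ((x : 'cV[R]_m) i 0)]
  = (\prod_(i < m) normal_prob 0 s (B i))%E.

Definition expmom (lam : R) : R := 1 + m%:R * (2 * expR ((m%:R * lam) ^+ 2 / 2)).

(** [a] and the quadratic form may be negative, so the majorant is integrated as a sum of integrable
    functions. The off-diagonal moments vanish and only the trace of [q] remains. *)
Lemma gaussian_quadratic_le (G : borelV R m -> R) (a bb lam : R) (q : 'I_m -> 'I_m -> R) :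
  measurable_fun setT G -> (forall e, 0 <= G e) -> 0 <= bb -> 0 <= lam ->
  (forall e : 'cV[R]_m, G e <= a + \sum_k \sum_l q k l * (e k 0 * e l 0)
     + bb * expR (lam * (norm1 e / s))) ->
  (\int[Q]_e (G e)%:E <= (a + s ^+ 2 * \sum_k q k k + bb * expmom lam)%:E)%E.
Proof.
move=> mG G0 bb0 lam0 Gle.
pose E (e : borelV R m) := (expR (lam * (norm1 (e : 'cV[R]_m) / s)))%:E.
have mE : measurable_fun setT E.
  apply/measurable_EFinP; apply: measurableT_comp => //.
  apply: measurable_funM => //; apply: measurable_funM => //.
  apply: measurable_sum => i; apply: measurableT_comp => //.
  exact: measurable_coordV.
have iE : Q.-integrable setT E.
  apply/integrableP; split => //.
  under eq_integral do rewrite gee0_abs ?lee_fin ?expR_ge0//.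
  exact: le_lt_trans (integral_exp_norm1 s_gt0 Qbox lam0) (ltry _).
have iQ (k l : 'I_m) : Q.-integrable setT (fun e : borelV R m =>
    (q k l)%:E * ((e : 'cV[R]_m) k 0%R * (e : 'cV[R]_m) l 0%R)%:E)%E.
  by apply: integrableZl => //; exact: integrable_coordM s_gt0 Qbox _ _.
have iQk (k : 'I_m) : Q.-integrable setT (fun e : borelV R m =>
    \sum_l (q k l)%:E * ((e : 'cV[R]_m) k 0%R * (e : 'cV[R]_m) l 0%R)%:E)%E.
  by apply: integrable_sum => // l _; exact: iQ.
have iQQ : Q.-integrable setT (fun e : borelV R m =>
    \sum_k \sum_l (q k l)%:E * ((e : 'cV[R]_m) k 0%R * (e : 'cV[R]_m) l 0%R)%:E)%E.
  by apply: integrable_sum => // k _; exact: iQk.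
have ia : Q.-integrable setT (fun=> a%:E).
  apply/integrableP; split => //.
  rewrite integral_cst// (gaussian_law_setT Qbox) mule1.
  exact: ltry.
have iaQ := integrableD measurableT ia iQQ.
have ib : Q.-integrable setT (fun e => bb%:E * E e)%E by exact: integrableZl.
have RHSE (e : 'cV[R]_m) : (a + \sum_k \sum_l q k l * (e k 0 * e l 0)
     + bb * expR (lam * (norm1 e / s)))%:E =
   (a%:E + \sum_k \sum_l (q k l)%:E * (e k 0%R * e l 0%R)%:E + bb%:E * E e)%E.
  rewrite !EFinD -EFinM -sumEFin; congr (_ + _ + _)%E.
  by apply: eq_bigr => k _; rewrite -sumEFin.
apply: (@le_trans _ _ (\int[Q]_e (a%:E + \sum_k \sum_l (q k l)%:E *
   ((e : 'cV[R]_m) k 0%R * (e : 'cV[R]_m) l 0%R)%:E + bb%:E * E e))%E).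
  apply: ge0_le_integral => //.
  - by move=> e _; rewrite lee_fin.
  - exact/measurable_EFinP.
  - exact: measurable_int (integrableD measurableT iaQ ib).
  - by move=> e _; rewrite -RHSE lee_fin; exact: Gle.
rewrite (integralD measurableT iaQ ib) (integralD measurableT ia iQQ).
rewrite integral_cst// (gaussian_law_setT Qbox) mule1.
rewrite (integral_sum measurableT iQk).
have -> : (\sum_k \int[Q]_e \sum_l (q k l)%:E *
   ((e : 'cV[R]_m) k 0%R * (e : 'cV[R]_m) l 0%R)%:E = (s ^+ 2 * \sum_k q k k)%:E)%E.
  rewrite mulr_sumr -sumEFin; apply: eq_bigr => k _.
  rewrite (integral_sum measurableT (iQ k)) (bigD1 k)//= big1 ?adde0.
    rewrite integralZl//; last exact: integrable_coordM s_gt0 Qbox _ _.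
    by rewrite (integral_coordM s_gt0 Qbox) eqxx mul1r -EFinM mulrC.
  move=> l lk; rewrite integralZl//; last exact: integrable_coordM s_gt0 Qbox _ _.
  by rewrite (integral_coordM s_gt0 Qbox) eq_sym (negbTE lk) mul0r mule0.
rewrite -EFinD [leRHS]EFinD leeD2l// ge0_integralZl//; last first.
  by move=> e _; rewrite lee_fin expR_ge0.
by rewrite EFinM lee_wpmul2l ?lee_fin//; exact: integral_exp_norm1.
Qed.

End gaussian_quadratic.
Arguments expmom {R} m lam.

Section one_step.
Context {R : realType} {d m : nat}.
Variables (p : nat) (gamma c : R) (V : 'cV[R]_d -> R).
Hypotheses (gamma_gt0 : 0 < gamma) (gammap : gamma <= p%:R^-1).
Hypotheses (VC : class_C p.+1 V) (V_ge0 : forall x, 0 <= V x) (c_gt0 : 0 < c).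
Hypothesis DV : forall x (s : nat), (s <= p)%N ->
  deriv_hs_norm s V x <= c * (1 + V x) `^ (1 - s%:R * gamma).

Definition step_constant (A : R) : R :=
  c * (1 + A) ^+ 4 * (1 + gamma * c * A) `^ gamma^-1.

(** The step size is written [k ^+ 2], so that [k] is the standard deviation of the noise. [Q] is
    any measure with the Gaussian values on boxes, ready to be the law of an increment. *)
Lemma one_step (n : nat) (k eta K rho : R) (Q : {measure set (borelV R m) -> \bar R})
    (x bv : 'cV[R]_d) (sg : 'M[R]_(d, m)) :
  (2 <= n)%N -> (n <= 4)%N -> (n <= p)%N ->
  0 < k -> k <= 1 -> 0 <= eta -> (k * eta) ^+ n <= k ^+ 2 -> 0 <= K -> 0 <= rho ->
  (forall B : 'I_m -> set R, (forall i, measurable (B i)) ->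
    Q [set x | forall i, B i ((x : 'cV[R]_m) i 0)]
    = (\prod_(i < m) normal_prob 0 k (B i))%E) ->
  hs_norm bv <= K * (1 + V x) `^ gamma * eta ->
  hs_norm sg <= K * (1 + V x) `^ gamma * eta ->
  ((gradient V x)^T *m bv) 0 0 + 2^-1 * \tr (hessian V x *m sg *m sg^T)
    <= rho * (1 + V x) ->
  (\int[Q]_e (V (x + k ^+ 2 *: bv + sg *m e))%:E <=
   (V x + k ^+ 2 * ((rho + 3 * step_constant (d%:R * K) * expmom m (4 + gamma^-1))
        * (1 + V x)))%:E)%E.
Proof.
move=> n2 n4 np k0 k1 eta0 etan K0 rho0 Qbox nb nsg gen.
(* The dimension enters through the passage from the Hilbert-Schmidt norm to [norm1]. *)
set A := d%:R * K; set U := 1 + V x; set lam := 4 + gamma^-1.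
have A0 : 0 <= A by rewrite mulr_ge0.
have G0 : 0 <= U `^ gamma by exact: powR_ge0.
have U0 : 0 <= U by rewrite addr_ge0.
have lam0 : 0 <= lam by rewrite addr_ge0// invr_ge0 ltW.
set w := k ^+ 2 *: bv; set y := x + w.
have S0 : 0 <= step_constant A.
  by rewrite !mulr_ge0 ?exprn_ge0 ?addr_ge0 ?powR_ge0 ?(ltW c_gt0).
have nw : norm1 w <= A * U `^ gamma * (k * (k * eta)).
  rewrite norm1Z ger0_norm ?exprn_ge0 ?(ltW k0)//.
  apply: le_trans (ler_wpM2l _ (norm1_hs_norm _)) _.
    by rewrite exprn_ge0// ltW.
  rewrite (_ : A * _ * _ = k ^+ 2 * (d%:R * (K * U `^ gamma * eta))); last by rewrite /A; ring.
  by rewrite ler_wpM2l ?exprn_ge0 ?(ltW k0)// ler_wpM2l.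
have nu (e : 'cV[R]_m) : norm1 (sg *m e) <= A * U `^ gamma * (k * eta * (norm1 e / k)).
  apply: le_trans (norm1_mulmx _ _) _.
  rewrite (_ : A * _ * _ = d%:R * (K * U `^ gamma * eta) * norm1 e); last first.
    by rewrite /A; field; rewrite gt_eqF.
  by rewrite ler_wpM2r ?norm1_ge0// ler_wpM2l.
pose F (e : borelV R m) := V (y + sg *m (e : 'cV[R]_m)).
have mF : measurable_fun setT F.
  have mV : measurable_fun setT (V : borelV R d -> R).
    by apply: continuous_measurableV; apply: VC.1 [::] _.
  apply: (measurableT_comp mV); apply: measurable_coordwise => i.
  have -> : (fun e : borelV R m => (y + sg *m (e : 'cV[R]_m)) i 0) =
     (fun e : borelV R m => y i 0 + \sum_j sg i j * (e : 'cV[R]_m) j 0).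
    by apply/funext => e; rewrite mxE [X in _ + X]mxE.
  apply: measurable_funD => //; apply: measurable_sum => j.
  by apply: measurable_funM => //; exact: measurable_coordV.
have mEF : measurable_fun setT (fun e => (F e)%:E) by exact/measurable_EFinP.
have F0 e : 0 <= F e by exact: V_ge0.
pose Ff (e : borelV R m) := F (flip (fun=> true) e).
have mFf : measurable_fun setT Ff by apply: (measurableT_comp mF); exact: measurable_flip.
have mEFf : measurable_fun setT (fun e => (Ff e)%:E) by exact/measurable_EFinP.
have dblE : (\int[Q]_e (F e)%:E + \int[Q]_e (F e)%:E = \int[Q]_e (F e + Ff e)%:E)%E.
  rewrite -{2}(@gaussian_law_flip _ _ _ _ k0 Qbox (fun=> true) (fun e => (F e)%:E))//.
  by rewrite -ge0_integralD// => e _; rewrite lee_fin F0.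
suff H : (\int[Q]_e (F e + Ff e)%:E <= (2 * (V x + k ^+ 2 * ((rho + 3 * step_constant A * expmom m lam) * U)))%:E)%E.
  have I0 : (0 <= \int[Q]_e (F e)%:E)%E by apply: integral_ge0 => e _; rewrite lee_fin F0.
  move: H I0; rewrite -dblE -/(F _).
  change (\int[Q]_e (V (y + sg *m (e : 'cV[R]_m)))%:E)%E with (\int[Q]_e (F e)%:E)%E.
  case: (\int[Q]_e (F e)%:E)%E => [r| |]//.
  by rewrite -EFinD !lee_fin => ? _; lra.
pose M (e : 'cV[R]_m) := step_constant A * (k ^+ 2 * U * expR (lam * (norm1 e / k))).
have M0 e : 0 <= M e.
  apply: mulr_ge0 => //; apply: mulr_ge0; last exact: expR_ge0.
  by rewrite mulr_ge0// exprn_ge0// ltW.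
have FfE (e : 'cV[R]_m) : Ff e = V (y - sg *m e) by rewrite /Ff /F flipT mulmxN.
have mFF : measurable_fun setT (F \+ Ff) by exact: measurable_funD.
have FF0 e : 0 <= (F \+ Ff) e by apply: addr_ge0; exact: V_ge0.
(* Six is twice three: [F \+ Ff] is twice the even average, whose bound has at most three
   remainders. *)
have bb0 : 0 <= 6 * step_constant A * (k ^+ 2 * U).
  by apply: mulr_ge0; apply: mulr_ge0 => //; rewrite exprn_ge0 ?(ltW k0).
have ex0 : 0 <= expmom m lam by rewrite /expmom addr_ge0// !mulr_ge0 ?expR_ge0.
have z0 (e : 'cV[R]_m) : 0 <= norm1 e / k by rewrite divr_ge0 ?norm1_ge0// ltW.
have ke0 : 0 <= k * eta by rewrite mulr_ge0// ltW.
have [n_2|n_3] := leqP n 2.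
  have n_eq2 : n = 2%N by apply/eqP; rewrite eqn_leq n_2 n2.
  have Gle (e : 'cV[R]_m) : (F \+ Ff) e <= 2 * V x + \sum_k \sum_l 0 * (e k 0 * e l 0)
      + 6 * step_constant A * (k ^+ 2 * U) * expR (lam * (norm1 e / k)).
    have := one_step_pointwise2 gamma_gt0 gammap VC V_ge0 c_gt0 DV n2 n4 np A0 k0 k1
       (z0 e) ke0 etan nw (nu e) n_eq2.
    rewrite -/(step_constant A) -/(M e) -/U -/y /= FfE /F => H.
    rewrite big1; last by move=> i _; rewrite big1// => j _; rewrite mul0r.
    have -> : 6 * step_constant A * (k ^+ 2 * U) * expR (lam * (norm1 e / k)) = 6 * M e.
      by rewrite /M; ring.
    have := M0 e; lra.
  apply: le_trans (gaussian_quadratic_le k0 Qbox mFF FF0 bb0 lam0 Gle) _.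
  rewrite lee_fin big1 // mulr0 addr0.
  have : 0 <= k ^+ 2 * (rho * U) by rewrite !mulr_ge0 ?exprn_ge0 ?(ltW k0).
  lra.
pose q (l l' : 'I_m) := \sum_i \sum_j sg i l * sg j l' * iter_partial [:: j; i] V x.
have Gle (e : 'cV[R]_m) : (F \+ Ff) e <= 2 * V x + 2 * k ^+ 2 * ((gradient V x)^T *m bv) 0 0
      + \sum_l \sum_l' q l l' * (e l 0 * e l' 0)
      + 6 * step_constant A * (k ^+ 2 * U) * expR (lam * (norm1 e / k)).
  have := one_step_pointwise3 gamma_gt0 gammap VC V_ge0 c_gt0 DV n2 n4 np A0 k0 k1
     (z0 e) ke0 etan nw (nu e) n_3.
  rewrite -/(step_constant A) -/(M e) -/U -/y => H.
  rewrite /= FfE /F.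
  have -> : 6 * step_constant A * (k ^+ 2 * U) * expR (lam * (norm1 e / k)) = 6 * M e.
    by rewrite /M; ring.
  have E1 : dirD V [:: w] [::] x = k ^+ 2 * ((gradient V x)^T *m bv) 0 0.
    rewrite /= mxE mulr_sumr; apply: eq_bigr => i _.
    by rewrite !mxE -mulrA (mulrC (bv i 0)).
  have E2 : dirD V [:: sg *m e; sg *m e] [::] x = \sum_l \sum_l' q l l' * (e l 0 * e l' 0).
    rewrite /=.
    transitivity (\sum_i \sum_j \sum_l \sum_l' sg i l * sg j l' * iter_partial [:: j; i] V x * (e l 0 * e l' 0)).
      apply: eq_bigr => i _; rewrite mulr_sumr; apply: eq_bigr => j _.
      rewrite !mxE mulr_suml; apply: eq_bigr => l _.
      rewrite mulr_suml mulr_sumr; apply: eq_bigr => l' _ /=; ring.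
    transitivity (\sum_l \sum_l' \sum_i \sum_j sg i l * sg j l' * iter_partial [:: j; i] V x * (e l 0 * e l' 0)).
      under eq_bigr do rewrite exchange_big.
      rewrite exchange_big; apply: eq_bigr => l _.
      under eq_bigr do rewrite exchange_big.
      by rewrite exchange_big.
    apply: eq_bigr => l _; apply: eq_bigr => l' _; rewrite /q mulr_suml.
    by apply: eq_bigr => i _; rewrite mulr_suml.
  rewrite E1 E2 in H.
  have := M0 e; lra.
apply: le_trans (gaussian_quadratic_le k0 Qbox mFF FF0 bb0 lam0 Gle) _.
have qtr : \sum_l q l l = \tr (hessian V x *m sg *m sg^T).
  rewrite /mxtrace.
  transitivity (\sum_i \sum_l (hessian V x *m sg) i l * sg i l); last first.
    apply: eq_bigr => i _; rewrite [RHS]mxE; apply: eq_bigr => l _.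
    by rewrite [sg^T _ _]mxE.
  (* [dirD] and [hessian] list the two partial derivatives in opposite orders; renaming the
     summation indices reconciles them without symmetry of the Hessian. *)
  rewrite [RHS]exchange_big; apply: eq_bigr => l _; rewrite /q exchange_big.
  apply: eq_bigr => i _; rewrite mxE mulr_suml; apply: eq_bigr => j _.
  rewrite !mxE /=; ring.
rewrite lee_fin qtr.
have := ler_wpM2l (exprn_ge0 2 (ltW k0)) gen; rewrite -/U.
set tt := \tr _; set gg := ((_)^T *m _) 0 0; set ss := step_constant A.
set ee := expmom m lam; set kk := k ^+ 2; clearbody tt gg ss ee kk => H.
have : 2 * (kk * (gg + 2^-1 * tt)) <= 2 * (kk * (rho * U)) by lra.
nra.
Qed.

End one_step.

(** * Growth of the coefficients on the ball of radius h^-r *)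

Section coefficient_growth.
Context {R : realType} {d m : nat}.
Variables (T : R) (b : R -> 'cV[R]_d -> 'cV[R]_d) (sigma : R -> 'cV[R]_d -> 'M[R]_(d, m)).
Variables (p : nat) (gamma : R) (V : 'cV[R]_d -> R).
Variables (K kappa nu q beta2 r : R).
Hypotheses (hp : (2 <= p)%N) (gamma_gt0 : 0 < gamma) (V_ge0 : forall x, 0 <= V x).
Hypotheses (hK : 0 < K) (hkappa : 0 < kappa).
Hypothesis hgrowth : forall (t : R) (x : 'cV[R]_d), 0 <= t <= T ->
  Num.max (hs_norm (b t x)) (hs_norm (sigma t x)) <= K * (1 + V x `^ (kappa * gamma)).
Hypotheses (hnu : 0 < nu) (hq : 0 < q).
Hypothesis hVub : forall x, V x <= nu * (1 + hs_norm x `^ q).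
Hypothesis hbeta2 : beta2 <= 2^-1 - (minn p 4)%:R^-1.
Hypothesis hr : 0 < r.
Hypothesis hrle : kappa != 1 -> r <= beta2 / ((kappa - 1) * q * gamma).

Let U_ge1 x : 1 <= 1 + V x. Proof. by rewrite lerDl. Qed.

Let G_ge1 x : 1 <= (1 + V x) `^ gamma.
Proof. by rewrite -[leLHS](powRr0 (1 + V x)) ler_powR// ltW. Qed.

Let max_le t x B : 0 <= t <= T -> K * (1 + V x `^ (kappa * gamma)) <= B ->
  hs_norm (b t x) <= B /\ hs_norm (sigma t x) <= B.
Proof.
move=> tT KB; have := le_trans (hgrowth x tT) KB.
by rewrite ge_max => /andP[].
Qed.

Let V_powR x : V x `^ (kappa * gamma) <= (1 + V x) `^ (kappa * gamma).
Proof.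
rewrite ge0_ler_powR ?nnegrE ?addr_ge0 ?mulr_ge0 ?(ltW hkappa) ?(ltW gamma_gt0)//.
by rewrite lerDr.
Qed.

Let growth_sublinear : kappa <= 1 -> forall t x, 0 <= t <= T ->
  hs_norm (b t x) <= 2 * K * (1 + V x) `^ gamma /\
  hs_norm (sigma t x) <= 2 * K * (1 + V x) `^ gamma.
Proof.
move=> k1 t x tT; apply: max_le tT _.
rewrite -mulrA mulrCA ler_pM2l// mulr2n mulrDl mul1r.
apply: lerD; first exact: G_ge1.
by apply: le_trans (V_powR x) _; rewrite ler_powR// ler_piMl// ltW.
Qed.

(** One factor (1 + V)^gamma is kept, and the excess power (kappa - 1) gamma is at most a constant
    times h^(-r q (kappa - 1) gamma) on the ball; the condition on [r] bounds this by h^-beta2. As r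
    > 0 forces beta2 > 0, the case p = 2 is excluded. *)
Let growth_superlinear : 1 < kappa ->
  [/\ 0 < beta2, (2 < p)%N & forall h t x, 0 < h <= 1 -> 0 <= t <= T ->
  hs_norm x <= h `^ (- r) ->
  hs_norm (b t x) <= 2 * K * (1 + 2 * nu) `^ ((kappa - 1) * gamma)
      * (1 + V x) `^ gamma * h `^ (- beta2) /\
  hs_norm (sigma t x) <= 2 * K * (1 + 2 * nu) `^ ((kappa - 1) * gamma)
      * (1 + V x) `^ gamma * h `^ (- beta2)].
Proof.
move=> k1; have D0 : 0 < (kappa - 1) * q * gamma by rewrite !mulr_gt0// subr_gt0.
have /hrle : kappa != 1 by rewrite gt_eqF.
rewrite ler_pdivlMr// => rb.
have b0 : 0 < beta2 by apply: lt_le_trans rb; exact: mulr_gt0.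
split => //.
  rewrite ltn_neqAle hp andbT; apply/eqP => p2; move: hbeta2; rewrite -p2 /minn /=.
  by rewrite subrr leNgt b0.
move=> h t x /andP[h0 h1] tT xh; apply: max_le tT _.
have ka0 : 0 <= (kappa - 1) * gamma by rewrite mulr_ge0 ?subr_ge0 ?(ltW k1) ?(ltW gamma_gt0).
have h01 : 0 < h <= 1 by rewrite h0.
have hge1 a : 0 <= a -> 1 <= h `^ (- a).
  by move=> a0; rewrite -[leLHS](powRr0 h) ger_powR// oppr_le0.
have rq0 : 0 <= r * q by rewrite mulr_ge0// ltW.
(* From 1 + nu + nu |x|^q, all the terms being compared with h^(-r q) >= 1. *)
have Ule : 1 + V x <= (1 + 2 * nu) * h `^ (- (r * q)).
  have xq : hs_norm x `^ q <= h `^ (- (r * q)).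
    rewrite -mulNr powRrM ge0_ler_powR ?nnegrE ?powR_ge0 ?(ltW hq)//.
    by rewrite /hs_norm sqrtr_ge0.
  have H1 := hge1 _ rq0.
  have := hVub x.
  have : nu * hs_norm x `^ q <= nu * h `^ (- (r * q)) by rewrite ler_pM2l.
  have : nu * 1 <= nu * h `^ (- (r * q)) by rewrite ler_pM2l.
  lra.
have C1 : 1 <= (1 + 2 * nu) `^ ((kappa - 1) * gamma).
  by rewrite -[leLHS](powRr0 (1 + 2 * nu)) ler_powR// lerDl mulr_ge0// ltW.
have H1 := hge1 _ (ltW b0).
have Upow : (1 + V x) `^ ((kappa - 1) * gamma) <=
    (1 + 2 * nu) `^ ((kappa - 1) * gamma) * h `^ (- beta2).
  have n20 : 0 <= 1 + 2 * nu by rewrite addr_ge0// mulr_ge0// ltW.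
  apply: (@le_trans _ _ (((1 + 2 * nu) * h `^ (- (r * q))) `^ ((kappa - 1) * gamma))).
    by rewrite ge0_ler_powR ?nnegrE ?addr_ge0// mulr_ge0 ?powR_ge0.
  rewrite powRM ?powR_ge0// ler_wpM2l ?powR_ge0// -powRrM ger_powR//.
  by rewrite mulNr lerN2; lra.
set G := (1 + V x) `^ gamma; set cc := _ `^ ((kappa - 1) * gamma) in C1 Upow *.
set hb := h `^ _ in H1 Upow *.
have G1 : 1 <= G by exact: G_ge1.
have Vk : V x `^ (kappa * gamma) <= G * (cc * hb).
  apply: le_trans (V_powR x) _.
  have -> : kappa * gamma = gamma + (kappa - 1) * gamma by ring.
  rewrite powRD; last first.
    by apply/implyP => _; rewrite gt_eqF// (lt_le_trans ltr01 (U_ge1 x)).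
  by rewrite ler_wpM2l ?powR_ge0.
have one : 1 <= G * (cc * hb) by rewrite mulr_ege1// mulr_ege1.
rewrite (_ : 2 * K * cc * G * hb = K * (G * (cc * hb) + G * (cc * hb))); last by ring.
by rewrite ler_pM2l// lerD.
Qed.

(* eta compensates the superlinear growth: it is [1] when [kappa <= 1] and
   [h `^ (- beta2)] otherwise, and n is the order of the Taylor expansion for
   which [(sqrt h * eta) ^ n <= h]. *)
Lemma coefficient_growth : exists n K1, [/\ (2 <= n)%N, (n <= 4)%N, (n <= p)%N, 0 <= K1 &
  forall h, 0 < h <= 1 -> exists eta, [/\ 0 <= eta, (Num.sqrt h * eta) ^+ n <= h &
    forall t x, 0 <= t <= T -> hs_norm x <= h `^ (- r) ->
      hs_norm (b t x) <= K1 * (1 + V x) `^ gamma * eta /\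
      hs_norm (sigma t x) <= K1 * (1 + V x) `^ gamma * eta]].
Proof.
have [k1|k1] := leP kappa 1.
  exists 2%N, (2 * K); split => //; first by rewrite mulr_ge0// ltW.
  move=> h /andP[h0 h1]; exists 1; split => //.
    by rewrite mulr1 sqr_sqrtr// ltW.
  by move=> t x tT _; rewrite mulr1; exact: growth_sublinear.
have [b0 p3 H] := growth_superlinear k1.
exists (minn p 4), (2 * K * (1 + 2 * nu) `^ ((kappa - 1) * gamma)); split => //.
- by rewrite leq_min hp.
- exact: geq_minr.
- exact: geq_minl.
- by rewrite !mulr_ge0 ?powR_ge0// ltW.
move=> h h01; exists (h `^ (- beta2)); split; first exact: powR_ge0.
  have /andP[h0 h1] := h01; have hn0 : h != 0 by rewrite gt_eqF.
  rewrite -powR12_sqrt ?(ltW h0)// -powRD; last by rewrite hn0 implybT.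
  rewrite -powR_mulrn ?powR_ge0// -powRrM.
  (* As h <= 1, the claim becomes (1/2 - beta2) n >= 1, which is the condition on [beta2]. *)
  rewrite -[leRHS](powRr1 (ltW h0)) ger_powR//.
  have n0 : 0 < (minn p 4)%:R :> R by rewrite ltr0n leq_min (ltn_trans _ p3).
  rewrite -ler_pdivrMr// div1r lerBrDl -lerBrDr; exact: hbeta2.
by move=> t x tT xh; exact: H.
Qed.

End coefficient_growth.

(** * Independence and iteration of the scheme *)

Section independence.
Context {R : realType} {d0 d1 d2 : measure_display} {Omega : measurableType d0}
  {T1 : measurableType d1} {T2 : measurableType d2}.
Variables (P : probability Omega R) (X : {mfun Omega >-> T1}) (Y : {mfun Omega >-> T2}).
Hypothesis indep : forall A B, measurable A -> measurable B ->
  (P (X @^-1` A `&` Y @^-1` B) = P (X @^-1` A) * P (Y @^-1` B))%E.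
Variable f : T1 * T2 -> \bar R.
Hypotheses (mf : measurable_fun setT f) (f0 : forall z, (0 <= f z)%E).

Lemma measurable_fun_law_section :
  measurable_fun setT (fun w => \int[distribution P Y]_y f (X w, y))%E.
Proof.
apply: (@measurableT_comp _ _ _ _ _ _ (fun x => \int[distribution P Y]_y f (x, y))%E) => //.
exact: measurable_fun_fubini_tonelli_F.
Qed.

(** The joint law is the product law, since the two agree on rectangles; Tonelli then freezes the
    first variable. *)
Lemma integral_independent :
  (\int[P]_w f (X w, Y w) = \int[P]_w \int[distribution P Y]_y f (X w, y))%E.
Proof.
have mXY : measurable_fun setT (fun w => (X w, Y w)) by exact: measurable_fun_pair.
pose nu : {measure set (T1 * T2) -> \bar R} := pushforward P (fun w => (X w, Y w)).
rewrite (@ge0_integral_law _ _ _ _ _ P (distribution P X \x distribution P Y)%E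
  (fun w => (X w, Y w)))//; last first.
  move=> A mA; apply/esym; apply: (@product_measure_unique _ _ _ _ _ _ _ (nu mXY)) => //.
rewrite fubini_tonelli1// /fubini_F.
rewrite -(@ge0_integral_law _ _ _ _ _ P (distribution P X) X)//.
- exact: measurable_fun_fubini_tonelli_F.
- by move=> x; exact: integral_ge0.
Qed.

End independence.

Section borel_continuity.
Context {R : realType}.

Lemma continuous_lipschitz_time {d k l : nat} (T : R) (b : R -> 'cV[R]_d -> 'M[R]_(k, l)) (t : R) :
  locally_lipschitz_on [set z : R * 'cV[R]_d | 0 <= z.1 <= T] (fun z => b z.1 z.2) ->
  0 <= t <= T -> continuous (b t).
Proof.
move=> lb tT x; have [A nA [M [Mreal HM]]] := lb (t, x) tT.
(* The Lipschitz bound holds for every constant above [M]; [M1] is one that is also positive, to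
   divide by it. *)
pose M1 := Num.max (M + 1) 1.
have M1M : M < M1 by rewrite /M1 lt_max ltrDl ltr01.
have M10 : 0 < M1 by rewrite /M1 lt_max ltr01 orbT.
have {}HM := HM _ M1M.
suff : b t y @[y --> x] --> b t x by [].
apply: (@cvgrPdist_le _ 'M[R]_(k, l) _ (nbhs x) _ (b t) (b t x)).2 => eps eps0.
have nAx : \forall y \near x, A (t, y).
  have [[B C] [/= tB xC] sub] := nA.
  apply: (filterS _ xC) => y Cy; apply: (sub (t, y)); split => //=.
  exact: nbhs_singleton tB.
near=> y.
have Ay : A (t, y) by near: y.
have Ax : A (t, x) by exact: nbhs_singleton nA.
have := HM ((t, x), (t, y)) (conj (conj tT Ax) (conj tT Ay)).
move=> /= /le_trans; apply.
have -> : `|(t, x) - (t, y)| = `|x - y|.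
  rewrite prod_normE /= subrr normr0; apply/max_idPr.
  exact: normr_ge0.
rewrite -ler_pdivlMl//; near: y.
have cid : z @[z --> x] --> x by exact: cvg_id.
move/cvgrPdist_le : cid; apply; rewrite mulr_gt0// invr_gt0.
Unshelve. all: by end_near.
Qed.

Lemma continuous_sumr (U : topologicalType) (I : Type) (s : seq I) (f : I -> U -> R) :
  (forall i, continuous (f i)) -> continuous (fun x => \sum_(i <- s) f i x).
Proof.
move=> cf; elim: s => [|i s IH].
  rewrite (_ : (fun x => _) = cst 0); first exact: cst_continuous.
  by apply/funext => x; rewrite big_nil.
rewrite (_ : (fun x => _) = f i \+ (fun x => \sum_(j <- s) f j x)).
  by move=> x; apply: continuousD; [exact: cf|exact: IH].
by apply/funext => x; rewrite big_cons.
Qed.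

Lemma continuous_hs_norm {d : nat} : continuous (@hs_norm R d 1).
Proof.
move=> x; rewrite /hs_norm.
apply: (@continuous_comp _ _ _ (fun A : 'cV[R]_d => \sum_i \sum_j A i j ^+ 2) Num.sqrt).
  apply: continuous_sumr => i; apply: continuous_sumr => j A.
  apply: (@continuous_comp _ _ _ (fun A : 'cV[R]_d => A i j) (fun x : R => x ^+ 2)).
    exact: coord_continuous.
  exact: exprn_continuous.
exact: sqrt_continuous.
Qed.

End borel_continuity.

Lemma measurable_euler {R : realType} {d m : nat} (h : R)
    (bt : 'cV[R]_d -> 'cV[R]_d) (st : 'cV[R]_d -> 'M[R]_(d, m)) :
  continuous bt -> continuous st ->
  measurable_fun setT (fun z : borelV R d * borelV R m =>
    (z.1 : 'cV[R]_d) + h *: bt z.1 + st z.1 *m (z.2 : 'cV[R]_m) : borelV R d).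
Proof.
move=> cb cs; apply: measurable_coordwise => i.
have cfst (g : 'cV[R]_d -> R) : continuous g ->
    measurable_fun setT (fun z : borelV R d * borelV R m => g z.1).
  move=> cg; apply: (measurableT_comp (continuous_measurableV cg)).
  exact: measurable_fst.
have -> : (fun z : borelV R d * borelV R m =>
    ((z.1 : 'cV[R]_d) + h *: bt z.1 + st z.1 *m (z.2 : 'cV[R]_m)) i 0) =
  (fun z : borelV R d * borelV R m =>
    (z.1 : 'cV[R]_d) i 0 + h * bt z.1 i 0 + \sum_j st z.1 i j * (z.2 : 'cV[R]_m) j 0).
  apply/funext => z; rewrite mxE [X in X + _]mxE [X in _ + X + _]mxE.
  by rewrite [X in _ + X = _]mxE.
apply: measurable_funD.
  apply: measurable_funD.
    by apply: (cfst (fun x => x i 0)); exact: coord_continuous.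
  apply: measurable_funM => //.
  apply: (cfst (fun x => bt x i 0)) => x.
  apply: (@continuous_comp _ _ _ bt (fun A : 'cV[R]_d => A i 0)); first exact: cb.
  exact: coord_continuous.
apply: measurable_sum => j; apply: measurable_funM.
  apply: (cfst (fun x => st x i j)) => x.
  apply: (@continuous_comp _ _ _ st (fun A : 'M[R]_(d, m) => A i j)); first exact: cs.
  exact: coord_continuous.
by apply: (measurableT_comp (measurable_coordV j)); exact: measurable_snd.
Qed.

Section filtration.
Context {R : realType} {disp : measure_display} {Omega : measurableType disp}.
Variables (P : probability Omega R) (F : R -> set (set Omega)).
Hypothesis hF : filtration F.

Lemma filtration_measurable t m (X : Omega -> 'cV[R]_m) : 0 <= t ->
  measurable_wrt (F t) X -> measurable_fun setT (X : Omega -> borelV R m).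
Proof.
by case: hF => _ sF _ t0 mX _ B mB; rewrite setTI; apply: (sF t t0); exact: mX.
Qed.

Lemma filtration_le s t m (X : Omega -> 'cV[R]_m) : 0 <= s -> s <= t ->
  measurable_wrt (F s) X -> measurable_wrt (F t) X.
Proof.
by case: hF => _ _ Fle s0 st mX B mB; apply: (Fle s t) => //; exact: mX.
Qed.

(** Turns [F t] into a measurable type, so that the closure properties of measurable functions apply
    to adaptedness. Generating adds no set, as [F t] is already a sigma-algebra. *)
Lemma measurable_wrtP t m (X : Omega -> 'cV[R]_m) : 0 <= t ->
  measurable_wrt (F t) X <->
  measurable_fun setT (X : g_sigma_algebraType (F t) -> borelV R m).
Proof.
case: hF => sF _ _ t0.
have E : (measurable : set (set (g_sigma_algebraType (F t)))) = F t.
  by apply: measurable_g_measurableTypeE; exact: sF.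
split=> [mX _ B mB|mX B mB].
  by rewrite setTI E; exact: mX.
by have := mX measurableT B mB; rewrite setTI E.
Qed.

End filtration.

(** * Adaptedness of the scheme and the recursion for its moments *)

Section scheme.
Context {R : realType} {disp : measure_display} {Omega : measurableType disp}.
Variables (P : probability Omega R) (F : R -> set (set Omega)) (d m : nat).
Variables (W : R -> Omega -> 'cV[R]_m) (X0 : Omega -> 'cV[R]_d) (T : R).
Variables (b : R -> 'cV[R]_d -> 'cV[R]_d) (sigma : R -> 'cV[R]_d -> 'M[R]_(d, m)).
Hypotheses (hF : filtration F) (hW : wiener_process P F W).
Hypothesis hX0 : measurable_wrt (F 0) X0.
Hypotheses (cb : forall t, 0 <= t <= T -> continuous (b t))
  (cs : forall t, 0 <= t <= T -> continuous (sigma t)).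

Lemma increment_measurable s t : 0 <= s -> s <= t ->
  measurable_wrt (F t) (increment W s t).
Proof.
move=> s0 st; have [mW _ _ _ _] := hW.
have t0 : 0 <= t by exact: le_trans st.
apply/(measurable_wrtP hF _ t0); apply: measurable_coordwise => i.
have mWt := (measurable_wrtP hF (W t) t0).1 (mW t t0).
have mWs := (measurable_wrtP hF (W s) t0).1 (filtration_le hF s0 st (mW s s0)).
have -> : (fun w : g_sigma_algebraType (F t) => increment W s t w i 0) =
  (fun w : g_sigma_algebraType (F t) => W t w i 0 - W s w i 0).
  by apply/funext => w; rewrite /increment mxE [X in _ + X]mxE.
apply: measurable_funB.
  exact: (measurableT_comp (measurable_coordV i) mWt).
exact: (measurableT_comp (measurable_coordV i) mWs).
Qed.

Variables (r h : R) (Pi : 'cV[R]_d -> 'cV[R]_d).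
Hypotheses (h_gt0 : 0 < h) (hPi : projection_map r h Pi).

Local Notation X := (projected_scheme b sigma W X0 r h Pi).

Let time_ge0 k : 0 <= k%:R * h. Proof. by rewrite mulr_ge0// ltW. Qed.

Let time_le k : k%:R * h <= k.+1%:R * h.
Proof. by rewrite ler_pM2r// ler_nat. Qed.

Lemma measurable_projection : measurable_fun setT (Pi : borelV R d -> borelV R d).
Proof. by move=> _ B mB; rewrite setTI; exact: hPi.1. Qed.

Lemma scheme_le k w : hs_norm (X k w) <= h `^ (- r).
Proof.
by case: k => [|k] /=; [case: ifP => // _|]; rewrite hPi.2 ge_min lexx orbT.
Qed.

(** Adaptedness is what makes the next increment independent of [X k]. The restriction to times at
    most [T] is where continuity of the coefficients in space is available. *)
Lemma scheme_measurable k : k%:R * h <= T -> measurable_wrt (F (k%:R * h)) (X k).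
Proof.
elim: k => [_|k IH kT].
  rewrite mul0r; pose g (x : borelV R d) : borelV R d :=
    if hs_norm (x : 'cV[R]_d) <= h `^ (- r) then x else Pi x.
  have mg : measurable_fun setT g.
    apply: measurable_fun_ifT => //; last exact: measurable_projection.
    apply: measurable_fun_ler => //.
    by apply: continuous_measurableV; exact: continuous_hs_norm.
  move=> B mB.
  have -> : X 0%N @^-1` B = X0 @^-1` (g @^-1` B) by [].
  by apply: hX0; have := mg measurableT B mB; rewrite setTI.
have kT' : 0 <= k%:R * h <= T by rewrite time_ge0 (le_trans (time_le k)).
have t0 := time_ge0 k.+1.
apply/(measurable_wrtP hF _ t0).
have mX := (measurable_wrtP hF _ t0).1
  (filtration_le hF (time_ge0 k) (time_le k) (IH (le_trans (time_le k) kT))).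
have mI := (measurable_wrtP hF _ t0).1 (increment_measurable (time_ge0 k) (time_le k)).
apply: (measurableT_comp measurable_projection).
have mE := measurable_euler h (cb kT') (cs kT').
exact: (measurableT_comp mE (measurable_fun_pair mX mI)).
Qed.

Variables (p : nat) (gamma c : R) (V : 'cV[R]_d -> R).
Hypotheses (gamma_gt0 : 0 < gamma) (gammap : gamma <= p%:R^-1).
Hypotheses (VC : class_C p.+1 V) (V_ge0 : forall x, 0 <= V x) (c_gt0 : 0 < c).
Hypothesis DV : forall x (s : nat), (s <= p)%N ->
  deriv_hs_norm s V x <= c * (1 + V x) `^ (1 - s%:R * gamma).
Hypothesis Vmono : forall x y, hs_norm x <= hs_norm y -> V x <= V y.
Hypothesis h_le1 : h <= 1.
Variables (n : nat) (K1 eta rho : R).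
Hypotheses (n2 : (2 <= n)%N) (n4 : (n <= 4)%N) (np : (n <= p)%N) (K10 : 0 <= K1)
  (rho0 : 0 <= rho).
Hypotheses (eta0 : 0 <= eta) (etan : (Num.sqrt h * eta) ^+ n <= h).
Hypothesis growth : forall t x, 0 <= t <= T -> hs_norm x <= h `^ (- r) ->
  hs_norm (b t x) <= K1 * (1 + V x) `^ gamma * eta /\
  hs_norm (sigma t x) <= K1 * (1 + V x) `^ gamma * eta.
Hypothesis hL : forall (t : R) (x : 'cV[R]_d), 0 <= t <= T ->
  generator b sigma V t x <= rho * (1 + V x).

Let C : R := rho + 3 * step_constant gamma c (d%:R * K1) * expmom m (4 + gamma^-1).

Lemma scheme_V_measurable k : k%:R * h <= T -> measurable_fun setT (V \o X k).
Proof.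
move=> kT.
have mX := filtration_measurable hF (time_ge0 k) (scheme_measurable kT).
exact: (measurableT_comp (continuous_measurableV (VC.1 [::] isT)) mX).
Qed.

(** Independence replaces the increment by its law with [X k] frozen. The previous projection keeps
    [X k] in the ball, where the growth bounds hold, and the next one is dropped by monotonicity of
    V. *)
Lemma scheme_step k : k.+1%:R * h <= T ->
  (\int[P]_w (V (X k.+1 w))%:E <= \int[P]_w (V (X k w) + h * (C * (1 + V (X k w))))%:E)%E.
Proof.
move=> kT; have kT0 := le_trans (time_le k) kT.
have kT' : 0 <= k%:R * h <= T by rewrite time_ge0.
set t := k%:R * h in kT' kT0 *; set t' := k.+1%:R * h in kT *.
have tt' : t < t' by rewrite /t /t' ltr_pM2r// ltr_nat.
have mX : measurable_fun setT (X k : Omega -> borelV R d).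
  exact: (filtration_measurable hF (time_ge0 k) (scheme_measurable kT0)).
have mI : measurable_fun setT (increment W t t' : Omega -> borelV R m).
  apply: (filtration_measurable hF (time_ge0 k.+1)) => //.
  by apply: increment_measurable => //; [exact: time_ge0|exact: ltW].
pose mfX : {mfun Omega >-> borelV R d} :=
  HB.pack (X k : Omega -> borelV R d) (isMeasurableFun.Build _ _ _ _ _ mX).
pose mfI : {mfun Omega >-> borelV R m} :=
  HB.pack (increment W t t' : Omega -> borelV R m) (isMeasurableFun.Build _ _ _ _ _ mI).
pose E (z : borelV R d * borelV R m) : borelV R d :=
  (z.1 : 'cV[R]_d) + h *: b t z.1 + sigma t z.1 *m (z.2 : 'cV[R]_m).
have mE : measurable_fun setT E by exact: (measurable_euler h (cb kT') (cs kT')).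
pose f z := (V (E z))%:E.
have mV : measurable_fun setT (V : borelV R d -> R).
  exact: continuous_measurableV (VC.1 [::] isT).
have mf : measurable_fun setT f.
  by apply/measurable_EFinP; exact: (measurableT_comp mV mE).
have f0 z : (0 <= f z)%E by rewrite lee_fin.
have [_ _ _ indep law] := hW.
have ind A B : measurable A -> measurable B ->
    (P (mfX @^-1` A `&` mfI @^-1` B) = P (mfX @^-1` A) * P (mfI @^-1` B))%E.
  move=> mA mB; apply: indep => //; first exact: time_ge0.
  exact: (scheme_measurable kT0).
apply: (@le_trans _ _ (\int[P]_w f (mfX w, mfI w))%E).
  apply: ge0_le_integral => //.
  - by move=> w _; rewrite lee_fin.
  - by apply/measurable_EFinP; exact: scheme_V_measurable.
  - exact: (measurableT_comp mf (measurable_fun_pair mX mI)).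
  - by move=> w _; rewrite lee_fin; apply: Vmono; rewrite /= hPi.2 ge_min lexx.
rewrite (integral_independent ind mf f0).
apply: ge0_le_integral => //.
- by move=> w _; apply: integral_ge0.
- exact: measurable_fun_law_section.
- have mVX := scheme_V_measurable kT0.
  apply/measurable_EFinP; apply: measurable_funD => //.
  by apply: measurable_funM => //; apply: measurable_funM => //; exact: measurable_funD.
- move=> w _; rewrite /f /E /=.
  have [Hb Hs] := growth kT' (scheme_le k w).
  have sh0 : 0 < Num.sqrt h by rewrite sqrtr_gt0.
  have sh2 : Num.sqrt h ^+ 2 = h by rewrite sqr_sqrtr// ltW.
  have := @one_step R d m p gamma c V gamma_gt0 gammap VC V_ge0 c_gt0 DV n
    (Num.sqrt h) eta K1 rho (distribution P mfI) (X k w) (b t (X k w)) (sigma t (X k w))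
    n2 n4 np sh0.
  rewrite sh2; apply => //.
  + by rewrite -(@ler_pXn2r _ 2) ?nnegrE ?sqrtr_ge0// sh2 expr1n.
  + move=> B mB; rewrite /distribution /pushforward /=.
    have := law t t' B (time_ge0 k) tt' mB.
    by rewrite (_ : t' - t = h) // /t' /t -mulrBl -natrB// subSnn mul1r.
  + exact: hL.
Qed.

Lemma scheme_gronwall (a : R) k : 0 <= a -> k%:R * h <= T ->
  (\int[P]_w (V (X0 w))%:E <= a%:E)%E ->
  (\int[P]_w (V (X k w))%:E <= (expR (T * C) * (1 + a))%:E)%E.
Proof.
move=> a0 kT Ha.
have C0 : 0 <= C.
  rewrite /C addr_ge0// mulr_ge0//; last first.
    by rewrite /expmom addr_ge0// !mulr_ge0 ?expR_ge0.
  by rewrite !mulr_ge0 ?exprn_ge0 ?addr_ge0 ?powR_ge0 ?mulr_ge0 ?(ltW c_gt0).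
have hC0 : 0 <= h * C by rewrite mulr_ge0// ltW.
(* The shift by 1 makes the recursion purely multiplicative: the mean of 1 + V grows by a factor of
   at most 1 + h C. *)
have H : (\int[P]_w (V (X k w))%:E <= ((1 + h * C) ^+ k * (1 + a) - 1)%:E)%E.
  elim: k kT => [|k IH] kT.
    rewrite expr0 mul1r addrC addKr; apply: le_trans Ha.
    apply: ge0_le_integral => //.
    - by move=> w _; rewrite lee_fin.
    - by apply/measurable_EFinP; exact: scheme_V_measurable.
    - apply/measurable_EFinP.
      have mX0 := filtration_measurable hF (lexx 0) hX0.
      exact: (measurableT_comp (continuous_measurableV (VC.1 [::] isT)) mX0).
    - move=> w _; rewrite lee_fin /=; case: ifP => // _.
      by apply: Vmono; rewrite hPi.2 ge_min lexx.
  have kT0 := le_trans (time_le k) kT.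
  apply: le_trans (scheme_step kT) _.
  have mV : measurable_fun setT (fun w => (V (X k w))%:E).
    by apply/measurable_EFinP; exact: scheme_V_measurable.
  have -> : (\int[P]_w (V (X k w) + h * (C * (1 + V (X k w))))%:E =
    \int[P]_w ((h * C)%:E + (1 + h * C)%:E * (V (X k w))%:E))%E.
    by apply: eq_integral => w _; rewrite -EFinM -EFinD; congr _%:E; ring.
  rewrite ge0_integralD//; last 2 first.
  - by move=> w _; rewrite mule_ge0// lee_fin ?addr_ge0.
  - exact: emeasurable_funM.
  rewrite ge0_integralZl//; last 2 first.
  - by move=> w _; rewrite lee_fin.
  - by rewrite lee_fin addr_ge0.
  rewrite integral_cst// [X in (_ * X + _)%E](_ : _ = 1%E); last exact: probability_setT.
  rewrite mule1; apply: (@le_trans _ _ ((h * C)%:E + (1 + h * C)%:E * ((1 + h * C) ^+ k * (1 + a) - 1)%:E)%E).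
    by rewrite leeD2l// lee_wpmul2l ?lee_fin ?addr_ge0//; exact: IH.
  by rewrite -EFinM -EFinD lee_fin exprS; lra.
apply: le_trans H _; rewrite lee_fin.
apply: (@le_trans _ _ ((1 + h * C) ^+ k * (1 + a))); first by rewrite lerBlDr lerDl.
rewrite ler_wpM2r ?addr_ge0//.
apply: (@le_trans _ _ (expR (h * C) ^+ k)).
  by rewrite lerXn2r ?nnegrE ?addr_ge0 ?expR_ge0// expR_ge1Dx.
by rewrite -expRM_natl ler_expR mulrA ler_wpM2r.
Qed.

End scheme.

Unset Implicit Arguments.

Theorem theorem2p2 (R : realType) (disp : measure_display)
  (Omega : measurableType disp) (P : probability Omega R)
  (F : R -> set (set Omega)) (d m : nat) (W : R -> Omega -> 'cV[R]_m)
  (X0 : Omega -> 'cV[R]_d) (T : R)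
  (b : R -> 'cV[R]_d -> 'cV[R]_d) (sigma : R -> 'cV[R]_d -> 'M[R]_(d, m))
  (p : nat) (gamma : R) (V : 'cV[R]_d -> R)
  (K kappa nu q rho beta2 r : R) (Pi : R -> 'cV[R]_d -> 'cV[R]_d)
  (hP : measure_is_complete P)
  (hF : filtration F) (hFr : right_continuous_filtration F)
  (hW : wiener_process P F W)
  (hX0 : measurable_wrt (F 0) X0)
  (hT : 0 < T)
  (hb : locally_lipschitz_on
          [set z : R * 'cV[R]_d | 0 <= z.1 <= T] (fun z => b z.1 z.2))
  (hsigma : locally_lipschitz_on
          [set z : R * 'cV[R]_d | 0 <= z.1 <= T] (fun z => sigma z.1 z.2))
  (hp : (2 <= p)%N) (hgamma : 0 < gamma <= p%:R^-1)
  (hV : lyapunov_class p gamma V)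
  (hK : 0 < K) (hkappa : 0 < kappa)
  (hgrowth : forall (t : R) (x : 'cV[R]_d), 0 <= t <= T ->
     Num.max (hs_norm (b t x)) (hs_norm (sigma t x))
       <= K * (1 + V x `^ (kappa * gamma)))
  (hnu : 0 < nu) (hq : 0 < q)
  (hVmono : forall x y, hs_norm x <= hs_norm y ->
     V x <= V y <= nu * (1 + hs_norm y `^ q))
  (hVX0 : ('E_P[V \o X0] < +oo)%E)
  (hrho : 0 < rho)
  (hL : forall (t : R) (x : 'cV[R]_d), 0 <= t <= T ->
     generator b sigma V t x <= rho * (1 + V x))
  (hbeta2 : beta2 <= 2^-1 - (minn p 4)%:R^-1)
  (hr : 0 < r)
  (* for kappa = 1 the bound on r is read as void *)
  (hrle : kappa != 1 -> r <= beta2 / ((kappa - 1) * q * gamma))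
  (hPi : forall h : R, 0 < h <= 1 -> projection_map r h (Pi h)) :
  V_integrable P T V
    (fun h => projected_scheme b sigma W X0 r h (Pi h)).
Proof.
have [VC V0 _ [c c0 DV]] := hV.
have /andP[g0 gp] := hgamma.
have Vmono x y : hs_norm x <= hs_norm y -> V x <= V y.
  by move=> /hVmono /andP[].
have Vub x : V x <= nu * (1 + hs_norm x `^ q).
  by have /andP[] := hVmono x x (lexx _).
have [n [K1 [n2 n4 np K10 Hh]]] := coefficient_growth hp g0 V0 hK hkappa hgrowth
  hnu hq Vub hbeta2 hr hrle.
have cb t : 0 <= t <= T -> continuous (b t) by exact: continuous_lipschitz_time.
have cs t : 0 <= t <= T -> continuous (sigma t) by exact: continuous_lipschitz_time.
have EV0 : (0 <= \int[P]_w (V (X0 w))%:E)%E.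
  by apply: integral_ge0 => w _; rewrite lee_fin.
have EVfin : (\int[P]_w (V (X0 w))%:E)%E \is a fin_num.
  by rewrite ge0_fin_numE//; move: hVX0; rewrite unlock.
pose a := fine (\int[P]_w (V (X0 w))%:E)%E.
have a0 : 0 <= a by rewrite fine_ge0.
have aE : (\int[P]_w (V (X0 w))%:E <= a%:E)%E by rewrite fineK.
pose C : R := rho + 3 * step_constant gamma c (d%:R * K1) * expmom m (4 + gamma^-1).
(* [n], [K1] and hence [C] were obtained before [h], and only [eta] depends on it: the bound is
   uniform. *)
apply: (@le_lt_trans _ _ (expR (T * C) * (1 + a))%:E); last exact: ltry.
apply: ge_ereal_sup => _ [h /= h01 <-].
have [eta [eta0 etan growth]] := Hh h h01.
have /andP[h0 h1] := h01.
apply/bigmax_leP; split=> [|k _]; first exact: leNye.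
(* The maximum includes the index [Num.truncn (T / h)], which still gives k h <= T. *)
have kT : k%:R * h <= T.
  have := ltn_ord k; rewrite ltnS truncn_ge_nat; last by rewrite divr_ge0// ltW.
  by rewrite ler_pdivlMr.
rewrite unlock.
exact: (scheme_gronwall hF hW hX0 cb cs h0 (hPi h h01) g0 gp VC V0 c0 DV Vmono h1
  n2 n4 np K10 (ltW hrho) eta0 etan growth hL a0 kT aE).
Qed.
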